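(* For every integer $n\ge 3$ the $(n+5)$-point quadrature formula $$Q_{n+5}[f]=\frac{43}{384n}\sigma(0)+\frac{69}{128n}\sigma\Big(\frac1{3n}\Big)-\frac{21}{128n}\sigma\Big(\frac2{3n}\Big)+\frac{389}{384n}\sigma\Big(\frac1n\Big)+\frac1n\sum_{k=2}^{n-2}f\Big(\frac kn\Big),\qquad \sigma(x):=f(x)+f(1-x),$$ is negative definite of order $4$, with error constant $$c_4(Q_{n+5})=-\frac{7}{5760\,n^4}\Big(1-\frac{55}{63\,n}\Big),$$ and the sequence $\{Q_{n+5}\}$ is asymptotically optimal negative definite of order $4$, i.e. $\lim_{n\to\infty}c_4(Q_{n+5})/c^{-}_{n+5,4}=1$.
   Context: An $N$-point quadrature formula is a functional $Q[f]=\sum_{i=1}^{N}a_i f(\tau_i)$ with nodes $0\le\tau_1<\dots<\tau_N\le 1$ and real weights; its remainder is $R[Q;f]=\int_0^1 f(x)\,dx-Q[f]$. $Q$ is negative definite of order $4$, with error constant $c_4(Q)$, if there is a constant $c_4(Q)<0$ such that for every $f\in C^4[0,1]$ there is $\xi\in[0,1]$ with $R[Q;f]=c_4(Q)f^{(4)}(\xi)$. $c^{-}_{N,4}$ denotes the supremum (largest negative value) of $c_4(Q)$ over all $N$-point negative definite quadrature formulae $Q$ of order $4$. Empty sums are $0$. *)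

(* Defs.v *)
From Stdlib Require Import Reals.
From Coquelicot Require Import Coquelicot.
Open Scope R_scope.

Definition I01 (x : R) : Prop := 0 <= x <= 1.

(* f belongs to C^r[0,1] and, on [0,1], d k is its k-th derivative (k <= r).
   D_in and continue_in are relative to [0,1], hence one-sided at 0 and 1;
   values outside [0,1] play no role. *)
Definition C_with_derivs (r : nat) (f : R -> R) (d : nat -> R -> R) : Prop :=
  (forall x, I01 x -> d 0%nat x = f x) /\
  (forall k x, (k < r)%nat -> I01 x -> D_in (d k) (d (S k)) I01 x) /\
  (forall x, I01 x -> continue_in (d r) I01 x).

(* Nodes and weights are indexed by 1, ..., N. *)
Definition is_quadrature (N : nat) (Q : (R -> R) -> R) : Prop :=
  exists a tau : nat -> R,
    (forall i, (1 <= i <= N)%nat -> I01 (tau i)) /\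
    (forall i j, (1 <= i)%nat -> (i < j)%nat -> (j <= N)%nat -> tau i < tau j) /\
    (forall f : R -> R, Q f = sum_n_m (fun i => a i * f (tau i)) 1 N).

Definition remainder (Q : (R -> R) -> R) (f : R -> R) : R := RInt f 0 1 - Q f.

(* Q is negative definite of order 4 with error constant c;
   such a c is unique, as f x = x ^ 4 / 24 shows. *)
Definition negative_definite4 (Q : (R -> R) -> R) (c : R) : Prop :=
  c < 0 /\
  forall (f : R -> R) (d : nat -> R -> R), C_with_derivs 4 f d ->
    exists xi, I01 xi /\ remainder Q f = c * d 4%nat xi.

(* The set is bounded above by 0, so its supremum is finite when it is
   nonempty; for an empty set the value is the junk value 0. *)
Definition c_minus4 (N : nat) : R :=
  real (Lub_Rbar (fun c =>
    exists Q, is_quadrature N Q /\ negative_definite4 Q c)).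

(* Q n is an (N n)-point formula, and only large n matter. *)
Definition asymptotically_optimal_negative4
    (N : nat -> nat) (Q : nat -> (R -> R) -> R) : Prop :=
  exists c : nat -> R,
    eventually (fun n => is_quadrature (N n) (Q n) /\
                         negative_definite4 (Q n) (c n)) /\
    is_lim_seq (fun n => c n / c_minus4 (N n)) 1.

(* The natural subtraction n - 2 is genuine for n >= 2, and sum_n_m is 0 over
   an empty range (n = 3). *)
Definition Q5 (n : nat) (f : R -> R) : R :=
  let nn := INR n in
  let sigma x := f x + f (1 - x) in
  43 / (384 * nn) * sigma 0
  + 69 / (128 * nn) * sigma (1 / (3 * nn))
  - 21 / (128 * nn) * sigma (2 / (3 * nn))
  + 389 / (384 * nn) * sigma (1 / nn)
  + 1 / nn * sum_n_m (fun k => f (INR k / nn)) 2 (n - 2).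

(* Main.v *)
Require Import Defs.
From Stdlib Require Import Reals Lra Lia Psatz Classical FunctionalExtensionality.
From Coquelicot Require Import Coquelicot.
Open Scope R_scope.

(** Definiteness: integrating by parts on each cell writes the remainder as the
integral of [K f''''], where the Peano kernel [K] is explicit and [K <= 0]; between
consecutive interior nodes it is [((y (1 - y)) ^ 2 / 24 - 1 / 384) / n ^ 4], [y] being
the fractional part of [n x].

Optimality: let [Q] be negative definite with [N] nodes. Negative definiteness says
that [R[Q; S] <= 0] for every cubic spline [S] with nonnegative third-derivative jumps.
Hence if [h = x ^ 4 / 24 - S] vanishes at all nodes, then [c_4(Q) <= R[Q; h]], which is
the integral of [h]. We rescale so that [0], [1] and the nodes cut out [M = N + 1]
cells of mean length 1, and look for [h] with double zeros at the nodes, with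
[h'' = - v_i / 24] at the [i]-th one and with one further knot in each cell. On a
cell, [h] is determined by its length and the two values [v_i], [v_(i+1)]. The only
constraint is that [h'''] jumps downwards at the nodes; the largest such [v] below
[3 / 2] has no jump at the nodes where [v_i < 3 / 2]. The integral of [h] is then bounded cell by
cell: a multiple [lagr v_i] of the jump, which is zero, is added at each node, after which
[- 5760] times the integral over a cell of length [l] is at least [35 l - 28], the
tangent at [l = 1] of the value [7 l ^ 5] for equidistant nodes. At nodes next to a
short cell one takes [v_i = 0], and the short cell makes up for the loss. Only the two
ends contribute an error, of lower order. *)

(** * The test spline on one cell *)

(* On a cell of length [l], let [h] be the function with fourth derivative 1 except for a jump
   [- jump l v w] of [h'''] at [knot l v w] and with [h = h' = 0] at both ends,
   [h'' = - v / 24] at the left end and [h'' = - w / 24] at the right end. Then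
   [h''' = jet l v w / 12] at the left end, [h''' = - jet l w v / 12] at the right end
   and [- 5760] times the integral of [h] is [cost l v w] (see [cell_step] and
   [cell_integral]). For [l = 0] and [v = w = 0] all of these evaluate to 0. *)
Definition jet l v w :=
  let A := 1 + v / (2 * l ^ 2) in let B := 1 + w / (2 * l ^ 2) in
  l * (A ^ 2 / B + 3 * A - 6).

Definition knot l v w :=
  let A := 1 + v / (2 * l ^ 2) in let B := 1 + w / (2 * l ^ 2) in l * (B / (A + B)).

Definition jump l v w :=
  let A := 1 + v / (2 * l ^ 2) in let B := 1 + w / (2 * l ^ 2) in
  l * ((A + B) ^ 3 / (12 * (A * B))).

Definition cost l v w :=
  let A := 1 + v / (2 * l ^ 2) in let B := 1 + w / (2 * l ^ 2) in
  20 * l ^ 5 * (A * B / (A + B)) - 8 * l ^ 5.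

(* The slope of [lagr] at 1 makes the quadratic form of the cell inequality positive
   definite at [l = v = w = 1]; its zero is the upper bound imposed on [v]. *)
Definition lagr v := 5 / 2 * (3 / 2 - v).

(** * Inequalities for a single cell *)

Lemma le_div a b c : 0 < c -> a * c <= b -> a <= b / c.
Proof. intros Hc H. now apply Rle_div_r. Qed.

Lemma div_le a b c : 0 < c -> a <= b * c -> a / c <= b.
Proof. intros Hc H. now apply Rle_div_l. Qed.

(** Convexity of the fifth power: the difference of the two sides is [(l - a) ^ 2] times a cubic
    with nonnegative coefficients. *)
Lemma pow5_tangent l a : 0 <= l -> 0 <= a -> 5 * a ^ 4 * l - 4 * a ^ 5 <= l ^ 5.
Proof.
  intros Hl Ha.
  assert (0 <= (l - a) ^ 2 * (l ^ 3 + 2 * a * l ^ 2 + 3 * a ^ 2 * l + 4 * a ^ 3)).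
  { apply Rmult_le_pos; [apply pow2_ge_0|].
    assert (0 <= a ^ 2) by (apply pow_le; lra). assert (0 <= a ^ 3) by (apply pow_le; lra).
    assert (0 <= l ^ 2) by (apply pow_le; lra). assert (0 <= l ^ 3) by (apply pow_le; lra).
    repeat apply Rplus_le_le_0_compat; try lra; repeat apply Rmult_le_pos; lra. }
  lra.
Qed.

Lemma div_sq_nonneg l v : 0 < l -> 0 <= v -> 0 <= v / (2 * l ^ 2).
Proof.
  intros Hl Hv. apply Rmult_le_pos; [exact Hv|].
  left; apply Rinv_0_lt_compat; nra.
Qed.

Lemma cost_ge l v w : 0 < l -> 0 <= v -> 0 <= w -> 2 * l ^ 5 <= cost l v w.
Proof.
  intros Hl Hv Hw. unfold cost.
  pose proof (div_sq_nonneg l v Hl Hv). pose proof (div_sq_nonneg l w Hl Hw).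
  set (x := v / (2 * l ^ 2)) in *. set (y := w / (2 * l ^ 2)) in *. cbv zeta.
  assert (E : 1 / 2 <= (1 + x) * (1 + y) / (1 + x + (1 + y))).
  { apply le_div; nra. }
  assert (0 <= l ^ 5) by (apply pow_le; lra). nra.
Qed.

(** A short cell has the value 0 at both ends, so its cost is [2 * l ^ 5]. The surplus 12 pays 6
    towards each end; [cut_cut_bound] and [cut_cell_bound] let longer cells spend these amounts. *)
Lemma short_cell_bound l : 0 <= l <= 9 / 20 -> 12 <= 2 * l ^ 5 - 35 * l + 28.
Proof. intros H. assert (0 <= l ^ 5) by (apply pow_le; lra). lra. Qed.

Lemma cut_cut_bound l : 0 <= l -> 0 <= 2 * l ^ 5 - 35 * l + 28 + 12.
Proof. intros Hl. pose proof (pow5_tangent l (11 / 8) Hl ltac:(lra)). lra. Qed.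

Lemma long_cell_tail l : 9 / 5 <= l -> 0 <= 2 * l ^ 5 - 35 * l + 28.
Proof. intros Hl. pose proof (pow5_tangent l (9 / 5) ltac:(lra) ltac:(lra)). lra. Qed.

(** Here [1 + v / (2 * l ^ 2) <= 5 / 4], and [(5 / 4) ^ 2 + 3 * (5 / 4) - 6 < 0]: on a very long
    cell the multiplier terms only help. *)
Lemma lagr_jet_tail l v w : 9 / 5 <= l -> 0 <= v <= 3 / 2 -> 0 <= w ->
  lagr v * jet l v w <= 0.
Proof.
  intros Hl Hv Hw. unfold lagr, jet. cbv zeta.
  assert (Hl0 : 0 < l) by lra.
  pose proof (div_sq_nonneg l v Hl0 (proj1 Hv)) as Hx.
  pose proof (div_sq_nonneg l w Hl0 Hw) as Hy.
  assert (Hx' : v / (2 * l ^ 2) <= 1 / 4).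
  { apply div_le; nra. }
  set (x := v / (2 * l ^ 2)) in *. set (y := w / (2 * l ^ 2)) in *.
  assert ((1 + x) ^ 2 / (1 + y) <= (1 + x) ^ 2).
  { apply div_le; nra. }
  assert ((1 + x) ^ 2 / (1 + y) + 3 * (1 + x) - 6 <= 0) by nra.
  assert (0 <= 5 / 2 * (3 / 2 - v)) by lra.
  assert (l * ((1 + x) ^ 2 / (1 + y) + 3 * (1 + x) - 6) <= 0) by nra.
  nra.
Qed.

(** The discriminant in [v] is [-5] times the expression in [D]. Its double root [l = 1], with
    [v = 1], is the equidistant case, where equality holds. *)
Lemma sym_bound l v : 9 / 20 <= l <= 2 ->
  0 <= 10 * v ^ 2 + v * (5 * l ^ 4 - 10 * l ^ 2 - 15) + 2 * l ^ 6 - 20 * l ^ 2 + 28 * l.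
Proof.
  intros [H1 H2].
  assert (D : 0 <= (l - 1) ^ 2 * (-5*l^6-10*l^5+21*l^4+52*l^3+93*l^2+134*l-45)).
  { apply Rmult_le_pos; [apply pow2_ge_0|].
    assert (0 <= l^3 * (2 - l)) by (apply Rmult_le_pos; [apply pow_le|]; lra).
    assert (0 <= l^4 * (2 - l)) by (apply Rmult_le_pos; [apply pow_le|]; lra).
    assert (0 <= l^5 * (2 - l)) by (apply Rmult_le_pos; [apply pow_le|]; lra).
    assert (0 <= l^3) by (apply pow_le; lra). assert (0 <= l^4) by (apply pow_le; lra).
    assert (0 <= l^2) by (apply pow_le; lra). nra. }
  assert (0 <= (20 * v + (5 * l ^ 4 - 10 * l ^ 2 - 15)) ^ 2) by apply pow2_ge_0.
  nra.
Qed.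

(** The slack in [long_cell_bound], in the variables [A = 1 + v / (2 * l ^ 2)] and
    [B = 1 + w / (2 * l ^ 2)]. *)
Definition excess l A B :=
  20 * l ^ 5 * (A * B / (A + B)) - 8 * l ^ 5 - 35 * l + 28
  - 5 / 2 * (3 / 2 - 2 * l ^ 2 * (A - 1)) * (l * (A ^ 2 / B + 3 * A - 6))
  - 5 / 2 * (3 / 2 - 2 * l ^ 2 * (B - 1)) * (l * (B ^ 2 / A + 3 * B - 6)).

(** This is [l] times the slack on the diagonal [v = w = s]. *)
Definition sym_part l s :=
  10 * s ^ 2 + s * (5 * l ^ 4 - 10 * l ^ 2 - 15) + 2 * l ^ 6 - 20 * l ^ 2 + 28 * l.

(** Since [A * B = al ^ 2 - e], the numerator is, for a fixed mean [al], a quadratic polynomial in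
    [e] whose constant term comes from the diagonal case. *)
Lemma excess_decomp l A B : 0 < l -> 0 < A -> 0 < B ->
  let al := (A + B) / 2 in let e := ((A - B) / 2) ^ 2 in let s := 2 * l ^ 2 * (al - 1) in
  excess l A B * (A * B) =
  sym_part l s / l * (al ^ 2 - e)
  + e * l * ((20 * l ^ 2 - 10 * l ^ 4 / al) * (al ^ 2 - e)
             + 20 * al * (2 * l ^ 2 + 2 * s - 3 / 2)).
Proof.
  intros Hl HA HB. cbv zeta. unfold excess, sym_part. field. lra.
Qed.

(** The case of the value 0 at one end. With [w] the other value, the hypotheses force [l <= 7 / 8]
    and [w <= 11 / 10]; the two products in [w] are bounded by their rounded maxima, attained at
    [w = 3 / 4] and [w = 1]. *)
Lemma excess_one_nonneg l A : 9 / 20 <= l -> 1 <= A -> 2 * l ^ 2 * (A - 1) <= 3 / 2 - 2 * l ^ 2 ->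
  0 <= excess l A 1.
Proof.
  intros Hl HA Hw.
  unfold excess. remember (2 * l ^ 2 * (A - 1)) as w eqn:Ew.
  assert (Hl2 : 81 / 400 <= l ^ 2) by nra.
  assert (Hw0 : 0 <= w) by (rewrite Ew; apply Rmult_le_pos; nra).
  assert (Hlu : l <= 7 / 8) by nra.
  assert (Hw1 : w <= 11 / 10) by nra.
  assert (C : 1 / 2 <= A * 1 / (A + 1)) by (apply le_div; nra).
  assert (J : 1 ^ 2 / A + 3 * 1 - 6 <= - 2).
  { assert (1 ^ 2 / A <= 1) by (apply div_le; nra). lra. }
  assert (HA2 : A = 1 + w / (2 * l ^ 2)) by (rewrite Ew; field; lra).
  assert (K : 5 / 2 * (3 / 2 - w) * (l * (A ^ 2 / 1 + 3 * A - 6))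
     <= 5 / 2 * (3 / 2 - w) * (- 2 * l) + 36 / 10 / l + 32 / 100 / l ^ 3).
  { replace (l * (A ^ 2 / 1 + 3 * A - 6)) with (-2 * l + 5 / 2 * w / l + w ^ 2 / 4 / l ^ 3)
      by (rewrite HA2; field; lra).
    assert (X : 5 / 2 * (3 / 2 - w) * (5 / 2 * w) <= 36 / 10)
      by (pose proof (pow2_ge_0 (w - 3 / 4)); lra).
    assert (Y : 5 / 2 * (3 / 2 - w) * (w ^ 2 / 4) <= 32 / 100).
    { assert (0 <= (w - 1) ^ 2 * (2 * w + 1)) by (apply Rmult_le_pos; [apply pow2_ge_0|lra]). nra. }
    assert (0 < / l) by (apply Rinv_0_lt_compat; lra).
    assert (0 < / l ^ 3) by (apply Rinv_0_lt_compat, pow_lt; lra).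
    unfold Rdiv in *. nra. }
  (* The slope [51 / 2] is 35 less [15 / 2] from the end with value 0 and less
     [5 * (3 / 2 - 11 / 10) = 2] from the other end. *)
  assert (Z : 36 / 10 / l + 32 / 100 / l ^ 3 <= 28 - 51 / 2 * l).
  { replace (36 / 10 / l + 32 / 100 / l ^ 3) with ((36 / 10 * l ^ 2 + 32 / 100) / l ^ 3) by (field; lra).
    apply div_le; [apply pow_lt; lra|].
    assert (Hq : 0 <= (l - 9/20) * (7/8 - l)) by (apply Rmult_le_pos; lra).
    assert (0 <= l * ((l - 9/20) * (7/8 - l))) by (apply Rmult_le_pos; lra).
    assert (0 <= l ^ 2 * ((l - 9/20) * (7/8 - l))) by (apply Rmult_le_pos; nra).
    nra. }
  assert (0 <= l ^ 5) by (apply pow_le; lra).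
  assert (0 <= 5 / 2 * (3 / 2 - 2 * l ^ 2 * (1 - 1)) * (l * (- (1 ^ 2 / A + 3 * 1 - 6) - 2))).
  { repeat apply Rmult_le_pos; lra. }
  nra.
Qed.

(** By [excess_decomp] this concerns a quadratic in [e]. If [2 * l ^ 2 + 2 * s >= 3 / 2], both of
    its parts are nonnegative; otherwise the extreme values of [e] suffice, which [sym_bound] and
    [excess_one_nonneg] settle. *)
Lemma excess_nonneg l A B : 9 / 20 <= l <= 9 / 5 -> 1 <= A -> 1 <= B ->
  2 * l ^ 2 * (A - 1) <= 3 / 2 -> 2 * l ^ 2 * (B - 1) <= 3 / 2 -> 0 <= excess l A B.
Proof.
  intros Hl HA HB HvA HvB.
  assert (HP : 0 < A * B) by nra.
  apply Rmult_le_reg_r with (A * B); [exact HP|]. rewrite Rmult_0_l.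
  pose proof (excess_decomp l A B ltac:(lra) ltac:(lra) ltac:(lra)) as D. cbv zeta in D.
  pose proof (excess_decomp l (A + B - 1) 1 ltac:(lra) ltac:(lra) ltac:(lra)) as D1. cbv zeta in D1.
  replace ((A + B - 1 + 1) / 2) with ((A + B) / 2) in D1 by field.
  rewrite D. set (al := (A + B) / 2) in *.
  assert (Hal : 1 <= al) by (unfold al; lra).
  set (e := ((A - B) / 2) ^ 2) in *.
  set (s := 2 * l ^ 2 * (al - 1)) in *.
  assert (He : 0 <= e) by apply pow2_ge_0.
  assert (HPe : A * B = al ^ 2 - e) by (unfold al, e; field).
  replace (((A + B - 1 - 1) / 2) ^ 2) with ((al - 1) ^ 2) in D1 by (unfold al; field).
  assert (HeE : e <= (al - 1) ^ 2) by (unfold e, al; nra).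
  assert (HS : 0 <= sym_part l s / l).
  { apply Rmult_le_pos; [apply sym_bound; lra | left; apply Rinv_0_lt_compat; lra]. }
  assert (Hl2 : 0 < l ^ 2) by (apply pow_lt; lra).
  assert (Hs0 : 0 <= s) by (unfold s; apply Rmult_le_pos; lra).
  destruct (Rle_dec 0 (2 * l ^ 2 + 2 * s - 3 / 2)) as [Hb | Hb].
  - apply Rplus_le_le_0_compat; [apply Rmult_le_pos; lra|].
    apply Rmult_le_pos; [apply Rmult_le_pos; lra|].
    assert (Hbr : 2 * l ^ 2 + 2 * s - 3 / 2 <= al * (2 * l ^ 2 + 2 * s - 3 / 2) ) by nra.
    assert (Hsal : 2 * l ^ 2 * al = 2 * l ^ 2 + s) by (unfold s; ring).
    assert (Hl45 : l ^ 2 <= 81 / 25) by nra.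
    assert (Hnum : 0 <= 20 * l ^ 2 * al - 10 * l ^ 4 + 20 * (2 * l ^ 2 + 2 * s - 3 / 2)).
    { replace (l ^ 4) with (l ^ 2 * l ^ 2) by ring. set (L := l ^ 2) in *. nra. }
    (* [al ^ 2 - e <= al ^ 2], so the last term is at least its value with [al ^ 2 - e] for [al ^ 2] *)
    apply Rle_trans with ((20 * l ^ 2 * al - 10 * l ^ 4 + 20 * (2 * l ^ 2 + 2 * s - 3 / 2)) / al * (al ^ 2 - e)).
    + apply Rmult_le_pos; [|lra]. apply Rmult_le_pos; [exact Hnum|].
      left; apply Rinv_0_lt_compat; lra.
    + replace (20 * al * (2 * l ^ 2 + 2 * s - 3 / 2))
        with (20 * (2 * l ^ 2 + 2 * s - 3 / 2) / al * al ^ 2) by (field; lra).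
      replace ((20 * l ^ 2 * al - 10 * l ^ 4 + 20 * (2 * l ^ 2 + 2 * s - 3 / 2)) / al * (al ^ 2 - e))
        with ((20 * l ^ 2 - 10 * l ^ 4 / al) * (al ^ 2 - e)
              + 20 * (2 * l ^ 2 + 2 * s - 3 / 2) / al * (al ^ 2 - e)) by (field; lra).
      assert (0 <= 20 * (2 * l ^ 2 + 2 * s - 3 / 2) / al).
      { apply Rmult_le_pos; [lra|]. left; apply Rinv_0_lt_compat; lra. }
      nra.
  - (* the numerator is concave in [e], and at the largest [e] one of [A], [B] is [1] *)
    assert (H1 : 0 <= excess l (A + B - 1) 1).
    { apply excess_one_nonneg; [lra|lra|]. unfold s, al in Hb. lra. }
    assert (HE : 0 <= excess l (A + B - 1) 1 * ((A + B - 1) * 1)) by (apply Rmult_le_pos; lra).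
    rewrite D1 in HE.
    set (c1 := 20 * l ^ 2 - 10 * l ^ 4 / al) in *.
    assert (Hc1 : 0 <= c1).
    { unfold c1. assert (10 * l ^ 4 / al <= 10 * l ^ 4).
      { apply div_le; [lra|]. assert (0 <= l ^ 4) by (apply pow_le; lra). nra. }
      replace (l ^ 4) with (l ^ 2 * l ^ 2) in H by ring. nra. }
    set (y := sym_part l s / l) in *.
    set (k := 20 * al * (2 * l ^ 2 + 2 * s - 3 / 2)) in *.
    set (m := (al - 1) ^ 2) in *.
    assert (0 <= y * al ^ 2) by (apply Rmult_le_pos; [exact HS|apply pow2_ge_0]).
    assert (0 <= l * c1) by (apply Rmult_le_pos; lra).
    destruct (Req_dec m 0) as [Hm | Hm].
    { replace e with 0 by lra. lra. }
    assert (Hm0 : 0 < m) by lra.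
    apply Rmult_le_reg_l with m; [exact Hm0|]. rewrite Rmult_0_r.
    (* Concavity made explicit: the chord between [e = 0] and [e = m], plus a nonnegative multiple
       of [e * (m - e)]. *)
    replace (m * (y * (al ^ 2 - e) + e * l * (c1 * (al ^ 2 - e) + k)))
      with ((m - e) * (y * al ^ 2) + e * (y * (al ^ 2 - m) + m * l * (c1 * (al ^ 2 - m) + k))
            + l * c1 * (e * (m - e) * m)) by ring.
    repeat apply Rplus_le_le_0_compat.
    + apply Rmult_le_pos; lra.
    + apply Rmult_le_pos; lra.
    + apply Rmult_le_pos; [lra|]. apply Rmult_le_pos; [apply Rmult_le_pos|]; lra.
Qed.

Lemma long_cell_bound l v w : 9 / 20 <= l -> 0 <= v <= 3 / 2 -> 0 <= w <= 3 / 2 ->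
  lagr v * jet l v w + lagr w * jet l w v <= cost l v w - 35 * l + 28.
Proof.
  intros Hl Hv Hw.
  destruct (Rle_dec l (9 / 5)) as [Hu | Hu].
  - pose proof (div_sq_nonneg l v ltac:(lra) (proj1 Hv)) as HA.
    pose proof (div_sq_nonneg l w ltac:(lra) (proj1 Hw)) as HB.
    pose proof (excess_nonneg l (1 + v / (2 * l ^ 2)) (1 + w / (2 * l ^ 2))
      ltac:(lra) ltac:(lra) ltac:(lra)) as H.
    unfold excess in H.
    replace (2 * l ^ 2 * (1 + v / (2 * l ^ 2) - 1)) with v in H by (field; lra).
    replace (2 * l ^ 2 * (1 + w / (2 * l ^ 2) - 1)) with w in H by (field; lra).
    specialize (H (proj2 Hv) (proj2 Hw)). unfold lagr, jet, cost. cbv zeta. lra.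
  - pose proof (lagr_jet_tail l v w ltac:(lra) Hv (proj1 Hw)).
    pose proof (lagr_jet_tail l w v ltac:(lra) Hw (proj1 Hv)).
    pose proof (cost_ge l v w ltac:(lra) (proj1 Hv) (proj1 Hw)).
    pose proof (long_cell_tail l ltac:(lra)). lra.
Qed.

Lemma cost_sym l v w : cost l v w = cost l w v.
Proof. unfold cost. cbv zeta. now rewrite (Rmult_comm (1 + v / _)), (Rplus_comm (1 + v / _)). Qed.

Lemma interval_products l lo hi : 0 <= lo <= l -> l <= hi ->
  0 <= (l - lo) * (hi - l) /\ 0 <= l * ((l - lo) * (hi - l)) /\ 0 <= l ^ 2 * ((l - lo) * (hi - l)).
Proof.
  intros H1 H2.
  assert (Hq : 0 <= (l - lo) * (hi - l)) by (apply Rmult_le_pos; lra).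
  repeat split; [exact Hq| |]; (apply Rmult_le_pos; [try apply pow_le; lra|exact Hq]).
Qed.

(** In [cut_cell_bound] this serves the end [w = 0], and [cut_cell_poly1] the end [w = 3 / 2]. On
    each subinterval [l ^ 5] is replaced by 0 or by a tangent, which leaves a quartic inequality. *)
Lemma cut_cell_poly0 l : 9 / 20 <= l <= 9 / 5 ->
  25 / 4 / l + 5 / 16 / l ^ 3 <= 2 * l ^ 5 - 55 / 2 * l + 34.
Proof.
  intros Hl.
  replace (25 / 4 / l + 5 / 16 / l ^ 3) with ((25 / 4 * l ^ 2 + 5 / 16) / l ^ 3) by (field; lra).
  apply div_le; [apply pow_lt; lra|].
  assert (H3 : 0 < l ^ 3) by (apply pow_lt; lra).
  destruct (Rle_dec l (4 / 5)); [|destruct (Rle_dec l (23 / 20))].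
  - apply Rle_trans with ((34 - 55 / 2 * l) * l ^ 3).
    + pose proof (interval_products l (9/20) (4/5) ltac:(lra) ltac:(lra)). nra.
    + assert (0 <= l ^ 5) by (apply pow_le; lra). apply Rmult_le_compat_r; lra.
  - apply Rle_trans with ((26 - 35 / 2 * l) * l ^ 3).
    + pose proof (interval_products l (4/5) (23/20) ltac:(lra) ltac:(lra)). nra.
    + pose proof (pow5_tangent l 1 ltac:(lra) ltac:(lra)). apply Rmult_le_compat_r; lra.
  - apply Rle_trans with ((2 * (5 * (5/4) ^ 4 * l - 4 * (5/4) ^ 5) + 34 - 55 / 2 * l) * l ^ 3).
    + pose proof (interval_products l (23/20) (9/5) ltac:(lra) ltac:(lra)). nra.
    + pose proof (pow5_tangent l (5/4) ltac:(lra) ltac:(lra)). apply Rmult_le_compat_r; lra.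
Qed.

Lemma cut_cell_poly1 l : 9 / 20 <= l <= 9 / 5 ->
  25 / 16 / l + 5 / 16 / l ^ 3 <=
  2 * l ^ 5 - 35 * l + 34 + 10 * l ^ 5 * ((6 * l ^ 2 + 1) / (4 * l ^ 2 + 1) ^ 2).
Proof.
  intros Hl.
  replace (25 / 16 / l + 5 / 16 / l ^ 3) with ((25 / 16 * l ^ 2 + 5 / 16) / l ^ 3) by (field; lra).
  apply div_le; [apply pow_lt; lra|].
  assert (H3 : 0 < l ^ 3) by (apply pow_lt; lra).
  assert (H2 : 0 < l ^ 2) by (apply pow_lt; lra).
  assert (H5 : 0 < l ^ 5) by (apply pow_lt; lra).
  (* [r] is a lower bound of [l ^ 2 * (6 * l ^ 2 + 1) / (4 * l ^ 2 + 1) ^ 2] on a subinterval: 0,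
     then [24 / 100] from [l = 4 / 5] on, then the value [28 / 100] at [l = 1]. *)
  assert (K : forall r, r * (4 * l ^ 2 + 1) ^ 2 <= l ^ 2 * (6 * l ^ 2 + 1) ->
     10 * r * l ^ 3 <= 10 * l ^ 5 * ((6 * l ^ 2 + 1) / (4 * l ^ 2 + 1) ^ 2)).
  { intros r Hr.
    replace (10 * l ^ 5 * ((6 * l ^ 2 + 1) / (4 * l ^ 2 + 1) ^ 2))
      with (10 * l ^ 3 * (l ^ 2 * (6 * l ^ 2 + 1) / (4 * l ^ 2 + 1) ^ 2)) by (field; nra).
    replace (10 * r * l ^ 3) with (10 * l ^ 3 * r) by ring.
    apply Rmult_le_compat_l; [lra|]. apply le_div; [apply pow_lt; lra|exact Hr]. }
  destruct (Rle_dec l (4 / 5)); [|destruct (Rle_dec l 1)].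
  - specialize (K 0 ltac:(nra)).
    apply Rle_trans with ((34 - 35 * l) * l ^ 3).
    + pose proof (interval_products l (9/20) (4/5) ltac:(lra) ltac:(lra)). nra.
    + apply Rmult_le_compat_r; lra.
  - assert (16 / 25 <= l ^ 2) by nra. specialize (K (24 / 100) ltac:(nra)).
    pose proof (pow5_tangent l 1 ltac:(lra) ltac:(lra)).
    apply Rle_trans with ((26 - 25 * l + 12 / 10 * (2 * l ^ 3)) * l ^ 3).
    + assert (512 / 1000 <= l ^ 3) by nra.
      pose proof (interval_products l (4/5) 1 ltac:(lra) ltac:(lra)). nra.
    + apply Rmult_le_compat_r; lra.
  - assert (1 <= l ^ 2) by nra. specialize (K (28 / 100) ltac:(nra)).
    pose proof (pow5_tangent l (6/5) ltac:(lra) ltac:(lra)).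
    (* tangent of [l ^ 3] at [l = 5 / 4] *)
    assert (75 / 16 * l - 125 / 32 <= l ^ 3).
    { assert (0 <= (l - 5/4) ^ 2 * (l + 5/2)) by (apply Rmult_le_pos; [apply pow2_ge_0|lra]). lra. }
    apply Rle_trans with ((2 * (5 * (6/5) ^ 4 * l - 4 * (6/5) ^ 5) + 34 - 35 * l
        + 28 / 10 * (75 / 16 * l - 125 / 32)) * l ^ 3).
    + pose proof (interval_products l 1 (9/5) ltac:(lra) ltac:(lra)). nra.
    + apply Rmult_le_compat_r; lra.
Qed.

(** The left end is cut to the value 0, and 6 is what the cell may overdraw there. Tangents give the
    minorant [c0 + c1 * w + c2 * w ^ 2] with [c2 >= 0]; one more tangent makes it linear, so only
    [w = 0] and [w = 3 / 2] have to be checked. *)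
Lemma cut_cell_bound l w : 9 / 20 <= l -> 0 <= w <= 3 / 2 ->
  lagr w * jet l w 0 <= cost l 0 w - 35 * l + 28 + 6.
Proof.
  intros Hl Hw.
  destruct (Rle_dec l (9 / 5)) as [Hu | Hu].
  - assert (E : cost l 0 w - 35 * l + 28 + 6 - lagr w * jet l w 0 =
       2 * l ^ 5 - 55 / 2 * l + 34 + 10 * l ^ 5 * w / (4 * l ^ 2 + w)
       - w * (5 * l + 75 / 8 / l) + w ^ 2 * (25 / 4 / l - 15 / 16 / l ^ 3)
       + 5 / 8 * w ^ 3 / l ^ 3).
    { unfold cost, lagr, jet. cbv zeta. field. nra. }
    assert (H5 : 0 < l ^ 5) by (apply pow_lt; lra).
    assert (H3 : 0 < / l ^ 3) by (apply Rinv_0_lt_compat, pow_lt; lra).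
    assert (H0 : 0 < / l) by (apply Rinv_0_lt_compat; lra).
    (* tangent lines at [w = 1] *)
    assert (T1 : (4 * l ^ 2 + 2 - w) / (4 * l ^ 2 + 1) ^ 2 <= 1 / (4 * l ^ 2 + w)).
    { apply le_div; [nra|]. replace ((4 * l ^ 2 + 2 - w) / (4 * l ^ 2 + 1) ^ 2 * (4 * l ^ 2 + w))
        with (((4 * l ^ 2 + 2 - w) * (4 * l ^ 2 + w)) / (4 * l ^ 2 + 1) ^ 2) by (field; nra).
      apply div_le; [apply pow_lt; nra|]. pose proof (pow2_ge_0 (w - 1)). lra. }
    assert (T3 : 2 * w ^ 2 - w <= w ^ 3).
    { assert (0 <= w * (w - 1) ^ 2) by (apply Rmult_le_pos; [lra|apply pow2_ge_0]). lra. }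
    set (D := / (4 * l ^ 2 + 1) ^ 2) in *.
    assert (HD : 0 < D) by (apply Rinv_0_lt_compat, pow_lt; nra).
    assert (T1' : 10 * l ^ 5 * w * ((4 * l ^ 2 + 2 - w) * D) <= 10 * l ^ 5 * w / (4 * l ^ 2 + w)).
    { replace (10 * l ^ 5 * w / (4 * l ^ 2 + w)) with (10 * l ^ 5 * w * (1 / (4 * l ^ 2 + w))) by (field; nra).
      apply Rmult_le_compat_l; [apply Rmult_le_pos; lra|exact T1]. }
    assert (T3' : 5 / 8 * (2 * w ^ 2 - w) / l ^ 3 <= 5 / 8 * w ^ 3 / l ^ 3).
    { unfold Rdiv. apply Rmult_le_compat_r; lra. }
    set (c2 := - 10 * l ^ 5 * D + 25 / 4 / l + 5 / 16 / l ^ 3).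
    assert (Hc2 : 0 <= c2).
    { assert (10 * l ^ 5 * D <= 25 / 4 / l).
      { unfold D. change (10 * l ^ 5 * / (4 * l ^ 2 + 1) ^ 2) with (10 * l ^ 5 / (4 * l ^ 2 + 1) ^ 2).
        apply div_le; [apply pow_lt; nra|].
        replace (25 / 4 / l * (4 * l ^ 2 + 1) ^ 2) with ((25 / 4 * (4 * l ^ 2 + 1) ^ 2) / l) by (field; lra).
        apply le_div; [lra|].
        replace (10 * l ^ 5 * l) with (10 * l ^ 2 * (l ^ 2) ^ 2) by ring. set (L := l ^ 2).
        assert (0 <= L <= 81 / 25) by (unfold L; nra). nra. }
      unfold c2, Rdiv in *. lra. }
    assert (Q : c2 * (2 * w - 1) <= c2 * w ^ 2).
    { apply Rmult_le_compat_l; [exact Hc2|]. pose proof (pow2_ge_0 (w - 1)). lra. }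
    pose proof (cut_cell_poly0 l ltac:(lra)) as P0.
    pose proof (cut_cell_poly1 l ltac:(lra)) as P1.
    set (c1 := 10 * l ^ 5 * (4 * l ^ 2 + 2) * D - 5 * l - 75 / 8 / l - 5 / 8 / l ^ 3).
    set (c0 := 2 * l ^ 5 - 55 / 2 * l + 34) in *.
    assert (R0 : 0 <= c0 - c2).
    { assert (0 < 10 * l ^ 5 * D) by (apply Rmult_lt_0_compat; lra). unfold c2. lra. }
    assert (R1 : 0 <= c0 + 3 / 2 * c1 + 2 * c2).
    { replace (c0 + 3 / 2 * c1 + 2 * c2) with
       (2 * l ^ 5 - 35 * l + 34 + 10 * l ^ 5 * ((6 * l ^ 2 + 1) * D) - (25 / 16 / l + 5 / 16 / l ^ 3)).
      unfold Rdiv in *. fold D in P1. lra.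
      unfold c0, c1, c2. field. lra. }
    assert (0 <= c0 + c1 * w + c2 * w ^ 2).
    { assert (0 <= (1 - 2 / 3 * w) * (c0 - c2) + 2 / 3 * w * (c0 + 3 / 2 * c1 + 2 * c2)).
      { apply Rplus_le_le_0_compat; apply Rmult_le_pos; lra. }
      lra. }
    assert (c0 + c1 * w + c2 * w ^ 2 <= cost l 0 w - 35 * l + 28 + 6 - lagr w * jet l w 0).
    { rewrite E. unfold c0, c1, c2. unfold Rdiv in *. lra. }
    lra.
  - pose proof (lagr_jet_tail l w 0 ltac:(lra) Hw ltac:(lra)).
    pose proof (cost_ge l 0 w ltac:(lra) ltac:(lra) (proj1 Hw)).
    pose proof (long_cell_tail l ltac:(lra)). lra.
Qed.

(** * Choice of the second derivatives at the nodes *)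

Lemma Lub_real_is_lub (E : R -> Prop) (x0 V : R) :
  E x0 -> (forall x, E x -> x <= V) -> is_lub E (real (Lub_Rbar E)).
Proof.
  intros H0 HV. pose proof (Lub_Rbar_correct E) as [Hu Hl].
  destruct (Lub_Rbar E) as [s| |] eqn:Es; simpl.
  - split.
    + intros x Hx. exact (Hu x Hx).
    + intros b Hb. exact (Hl (Finite b) Hb).
  - exfalso. exact (Hl (Finite V) HV).
  - exfalso. exact (Hu x0 H0).
Qed.

(* Perron's method: the set of subsolutions is closed under coordinatewise
   suprema because [G i] decreases in the two neighbouring values. *)
Lemma maximal_solution (G : nat -> R -> R -> R -> R) (V : R) (free : nat -> Prop) :
  0 <= V ->
  (forall i a a' b c c', free i -> 0 <= a <= a' -> 0 <= b -> 0 <= c <= c' ->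
     G i a' b c' <= G i a b c) ->
  (forall i a b c, free i -> continuity_pt (fun b => G i a b c) b) ->
  (forall i, free i -> G i 0 0 0 <= 0) ->
  ~ free 0%nat ->
  exists v : nat -> R, forall i, 0 <= v i <= V /\ (~ free i -> v i = 0) /\
    (free i -> G i (v (i - 1)%nat) (v i) (v (i + 1)%nat) <= 0 /\
       (v i < V -> G i (v (i - 1)%nat) (v i) (v (i + 1)%nat) = 0)).
Proof.
  intros HV Hmono Hcont H0 Hf0.
  set (S := fun v : nat -> R => forall i, 0 <= v i <= V /\ (~ free i -> v i = 0) /\
    (free i -> G i (v (i - 1)%nat) (v i) (v (i + 1)%nat) <= 0)).
  set (E := fun i x => exists v, S v /\ x = v i).
  set (vs := fun i => real (Lub_Rbar (E i))).
  assert (S0 : S (fun _ => 0)).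
  { intros i. split; [lra|]. split; [reflexivity|]. apply H0. }
  assert (Hlub : forall i, is_lub (E i) (vs i)).
  { intros i. apply Lub_real_is_lub with 0 V.
    - exists (fun _ => 0). split; [exact S0|reflexivity].
    - intros x (v & Hv & ->). apply Hv. }
  assert (Hge : forall v i, S v -> v i <= vs i).
  { intros v i Hv. apply (Hlub i). exists v. split; [exact Hv|reflexivity]. }
  assert (Hb : forall i, 0 <= vs i <= V).
  { intros i. split.
    - exact (Hge _ i S0).
    - apply (Hlub i). intros x (v & Hv & ->). apply Hv. }
  assert (SS : S vs).
  { intros i. split; [apply Hb|]. split.
    - intros Hn. apply Rle_antisym; [|apply Hb].
      apply (Hlub i). intros x (v & Hv & ->). right. now apply Hv.
    - intros Hi. apply Rnot_lt_le. intros Hpos.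
      destruct (Hcont i (vs (i - 1)%nat) (vs i) (vs (i + 1)%nat) Hi _ Hpos) as (d & Hd & Hnear).
      assert (exists v, S v /\ vs i - d < v i) as (v & Hv & Hvi).
      { apply NNPP. intros Hno.
        assert (vs i <= vs i - d); [|lra].
        apply (Hlub i). intros x (v & Hv & ->). apply Rnot_lt_le. intros Hlt.
        apply Hno. now exists v. }
      pose proof (Hge v i Hv) as Hle.
      destruct (Hv i) as ((Hvi0 & _) & _ & Hvf). specialize (Hvf Hi).
      assert (G i (vs (i - 1)%nat) (v i) (vs (i + 1)%nat) <= 0).
      { eapply Rle_trans; [apply Hmono|exact Hvf]; try assumption;
          (split; [apply Hv | now apply Hge]). }
      destruct (Req_dec (vs i) (v i)) as [Heq|Hneq].
      { rewrite Heq in Hpos. lra. }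
      assert (X : Rabs (G i (vs (i - 1)%nat) (v i) (vs (i + 1)%nat)
                 - G i (vs (i - 1)%nat) (vs i) (vs (i + 1)%nat))
            < G i (vs (i - 1)%nat) (vs i) (vs (i + 1)%nat)).
      { apply (Hnear (v i)). split; [split; [exact I|assumption]|].
        unfold dist; simpl; unfold Rdist. rewrite Rabs_left1; lra. }
      apply Rabs_def2 in X. lra. }
  exists vs. intros i. destruct (SS i) as (_ & Hz & Hf).
  split; [apply Hb|]. split; [exact Hz|]. intros Hi. specialize (Hf Hi). split; [exact Hf|].
  intros HltV. apply Rle_antisym; [exact Hf|]. apply Rnot_lt_le. intros Hneg.
  destruct (Hcont i (vs (i - 1)%nat) (vs i) (vs (i + 1)%nat) Hi
     (- G i (vs (i - 1)%nat) (vs i) (vs (i + 1)%nat)) ltac:(lra)) as (d & Hd & Hnear).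
  (* If the inequality were strict at a value below [V], raising that value slightly would give a
     larger subsolution. *)
  set (b := vs i + Rmin (d / 2) (V - vs i)).
  assert (Hm : 0 < Rmin (d / 2) (V - vs i)) by (apply Rmin_glb_lt; lra).
  pose proof (Rmin_l (d / 2) (V - vs i)). pose proof (Rmin_r (d / 2) (V - vs i)).
  assert (HGb : G i (vs (i - 1)%nat) b (vs (i + 1)%nat) <= 0).
  { assert (X : Rabs (G i (vs (i - 1)%nat) b (vs (i + 1)%nat)
                 - G i (vs (i - 1)%nat) (vs i) (vs (i + 1)%nat))
            < - G i (vs (i - 1)%nat) (vs i) (vs (i + 1)%nat)).
    { apply (Hnear b). split; [split; [exact I|unfold b; lra]|].
      unfold dist; simpl; unfold Rdist. rewrite Rabs_pos_eq; unfold b; lra. }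
    apply Rabs_def2 in X. lra. }
  set (v := fun j => if Nat.eq_dec j i then b else vs j).
  assert (Hvb : forall j, vs j <= v j).
  { intros j. unfold v. destruct (Nat.eq_dec j i) as [->|]; unfold b; lra. }
  (* For [i = 0] the truncated [i - 1] would be [i] itself. *)
  assert (i <> 0%nat) by (intros ->; contradiction).
  assert (Sv : S v).
  { intros j. destruct (Nat.eq_dec j i) as [->|Hj].
    - unfold v. destruct (Nat.eq_dec i i); [|lia].
      destruct (Nat.eq_dec (i - 1) i); [lia|]. destruct (Nat.eq_dec (i + 1) i); [lia|].
      pose proof (Hb i). split; [unfold b; lra|]. split; [contradiction|]. intros _; exact HGb.
    - assert (E1 : v j = vs j) by (unfold v; destruct (Nat.eq_dec j i); [contradiction|reflexivity]).
      rewrite E1. destruct (SS j) as (HA & HB & HC).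
      split; [exact HA|]. split; [exact HB|]. intros Hfj.
      eapply Rle_trans; [apply Hmono|exact (HC Hfj)]; try assumption; try apply HA;
        (split; [apply Hb|apply Hvb]). }
  pose proof (Hge v i Sv) as X. unfold v in X. destruct (Nat.eq_dec i i); [|lia].
  unfold b in X. lra.
Qed.

Fixpoint psum (f : nat -> R) (n : nat) : R :=
  match n with O => 0 | S k => psum f k + f k end.

Lemma jet_zero_nonpos l w : 0 <= l -> 0 <= w -> jet l 0 w <= 0.
Proof.
  intros Hl Hw. unfold jet. cbv zeta.
  destruct Hl as [Hl|<-]; [|lra].
  pose proof (div_sq_nonneg l w Hl Hw).
  assert ((1 + 0 / (2 * l ^ 2)) ^ 2 / (1 + w / (2 * l ^ 2)) <= 1).
  { apply div_le; [lra|]. unfold Rdiv. rewrite Rmult_0_l. lra. }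
  unfold Rdiv in *. rewrite Rmult_0_l in *. nra.
Qed.

(** The monotonicity that [maximal_solution] requires. *)
Lemma jet_mono l v w w' : 0 < l -> 0 <= w <= w' -> jet l v w' <= jet l v w.
Proof.
  intros Hl Hw. unfold jet. cbv zeta.
  pose proof (div_sq_nonneg l w Hl ltac:(lra)) as H1.
  assert (H2 : w / (2 * l ^ 2) <= w' / (2 * l ^ 2)).
  { apply Rmult_le_compat_r; [|lra]. left; apply Rinv_0_lt_compat; nra. }
  apply Rmult_le_compat_l; [lra|].
  assert (/ (1 + w' / (2 * l ^ 2)) <= / (1 + w / (2 * l ^ 2))) by (apply Rinv_le_contravar; lra).
  assert (0 <= (1 + v / (2 * l ^ 2)) ^ 2) by apply pow2_ge_0.
  unfold Rdiv at 1 4. nra.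
Qed.

Lemma jet_continuous l w v : continuity_pt (fun v => jet l v w) v.
Proof.
  unfold jet. cbv zeta. apply derivable_continuous_pt.
  unfold Rdiv. set (c := / (2 * l ^ 2)). set (d := / (1 + w * c)). reg.
Qed.

Lemma cost_zero l : cost l 0 0 = 2 * l ^ 5.
Proof. unfold cost. cbv zeta. unfold Rdiv. rewrite Rmult_0_l. field. Qed.

(** Interior nodes without an adjacent short cell, below [9 / 20], are free; all others are cut to
    0. The loss 12 is 6 at each end of the interval, where no neighbouring cell compensates. *)
Lemma node_values (M : nat) (l : nat -> R) :
  (1 <= M)%nat -> (forall i, 0 <= l i) ->
  exists v : nat -> R, (forall i, 0 <= v i <= 3 / 2) /\ v 0%nat = 0 /\ v M = 0 /\
    (forall i, (i < M)%nat -> l i < 9 / 20 -> v i = 0 /\ v (i + 1)%nat = 0) /\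
    (forall i, (1 <= i < M)%nat ->
       jet (l i) (v i) (v (i + 1)%nat) + jet (l (i - 1)%nat) (v i) (v (i - 1)%nat) <= 0) /\
    psum (fun i => 35 * l i - 28) M - 12 <= psum (fun i => cost (l i) (v i) (v (i + 1)%nat)) M.
Proof.
  intros HM Hl.
  set (free := fun i => (1 <= i < M)%nat /\ 9 / 20 <= l (i - 1)%nat /\ 9 / 20 <= l i).
  assert (dec : forall i, {free i} + {~ free i}).
  { intros i. unfold free.
    destruct (Compare_dec.le_dec 1 i); [|right; lia]. destruct (Compare_dec.lt_dec i M); [|right; lia].
    destruct (Rle_dec (9 / 20) (l (i - 1)%nat)); [|right; lra].
    destruct (Rle_dec (9 / 20) (l i)); [left; repeat split; assumption|right; lra]. }
  destruct (maximal_solution (fun i a b c => jet (l i) b c + jet (l (i - 1)%nat) b a) (3 / 2) free)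
    as [v Hv].
  - lra.
  - intros i a a' b c c' (_ & H1 & H2) Ha _ Hc.
    apply Rplus_le_compat; apply jet_mono; lra.
  - intros i a b c _.
    exact (continuity_pt_plus _ _ b (jet_continuous (l i) c b) (jet_continuous (l (i - 1)%nat) a b)).
  - intros i _. pose proof (jet_zero_nonpos (l i) 0 (Hl i)).
    pose proof (jet_zero_nonpos (l (i - 1)%nat) 0 (Hl _)). lra.
  - unfold free. lia.
  - assert (Hb : forall i, 0 <= v i <= 3 / 2) by (intros i; apply Hv).
    assert (Hz : forall i, ~ free i -> v i = 0) by (intros i; apply Hv).
    exists v. split; [exact Hb|]. split; [apply Hz; unfold free; lia|].
    split; [apply Hz; unfold free; lia|]. split; [|split].
    + intros i Hi Hs. split; apply Hz; unfold free; [lra|].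
      replace (i + 1 - 1)%nat with i by lia. lra.
    + intros i Hi. destruct (dec i) as [Hf|Hf]; [now apply Hv|].
      rewrite (Hz i Hf).
      pose proof (jet_zero_nonpos (l i) (v (i + 1)%nat) (Hl i) (proj1 (Hb _))).
      pose proof (jet_zero_nonpos (l (i - 1)%nat) (v (i - 1)%nat) (Hl _) (proj1 (Hb _))). lra.
    (* Charges of a node to the cells on its right and left. At a free node they are the multiplier
       terms; at a cut node a short cell pays 6 and a longer one receives 6. *)
    + set (rt := fun i => if dec i then lagr (v i) * jet (l i) (v i) (v (i + 1)%nat)
                  else if Rlt_dec (l i) (9 / 20) then 6 else - 6).
      set (lt := fun i => if dec i then lagr (v i) * jet (l (i - 1)%nat) (v i) (v (i - 1)%nat)
                  else if Rlt_dec (l (i - 1)%nat) (9 / 20) then 6 else - 6).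
      assert (Hcell : forall i, (i < M)%nat ->
         rt i + lt (i + 1)%nat <= cost (l i) (v i) (v (i + 1)%nat) - 35 * l i + 28).
      { intros i Hi. unfold rt, lt. replace (i + 1 - 1)%nat with i by lia.
        pose proof (Hb i). pose proof (Hb (i + 1)%nat).
        destruct (Rlt_dec (l i) (9 / 20)) as [Hs|Hs].
        - destruct (dec i) as [Hf|Hf]; [unfold free in Hf; lra|].
          destruct (dec (i + 1)%nat) as [Hf'|Hf'].
          { unfold free in Hf'. replace (i + 1 - 1)%nat with i in Hf' by lia. lra. }
          rewrite (Hz _ Hf), (Hz _ Hf'), cost_zero.
          pose proof (short_cell_bound (l i)). pose proof (Hl i). lra.
        - destruct (dec i) as [Hf|Hf], (dec (i + 1)%nat) as [Hf'|Hf'].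
          + apply long_cell_bound; lra.
          + rewrite (Hz _ Hf'), cost_sym.
            pose proof (cut_cell_bound (l i) (v i)). lra.
          + rewrite (Hz _ Hf).
            pose proof (cut_cell_bound (l i) (v (i + 1)%nat)). lra.
          + rewrite (Hz _ Hf), (Hz _ Hf'), cost_zero.
            pose proof (cut_cut_bound (l i)). lra. }
      (* Complementary slackness at a free node: [lagr] vanishes at [3 / 2], and the jump vanishes
         below. A cut interior node adjoins at least one short cell. *)
      assert (Hnode : forall i, (1 <= i < M)%nat -> 0 <= lt i + rt i).
      { intros i Hi. unfold rt, lt. destruct (dec i) as [Hf|Hf].
        - destruct (Hv i) as (_ & _ & H). specialize (H Hf). destruct H as [_ H].
          destruct (Req_dec (v i) (3 / 2)) as [E|E].
          + rewrite E. unfold lagr. lra.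
          + pose proof (Hb i). rewrite <- Rmult_plus_distr_l, Rplus_comm, H; lra.
        - destruct (Rlt_dec (l (i - 1)%nat) (9 / 20)), (Rlt_dec (l i) (9 / 20)); try lra.
          exfalso. apply Hf. unfold free. repeat split; try lia; lra. }
      assert (Hsum : forall k, (k < M)%nat ->
         psum (fun i => 35 * l i - 28) (S k) + rt 0%nat + lt (S k)
         <= psum (fun i => cost (l i) (v i) (v (i + 1)%nat)) (S k)).
      { induction k as [|k IH]; intros Hk.
        - simpl. pose proof (Hcell 0%nat ltac:(lia)) as X. simpl in X. lra.
        - specialize (IH ltac:(lia)). pose proof (Hnode (S k) ltac:(lia)).
          pose proof (Hcell (S k) ltac:(lia)) as X. simpl in X, IH |- *.
          replace (k + 1)%nat with (S k) in * by lia. lra. }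
      destruct M as [|M']; [lia|].
      specialize (Hsum M' ltac:(lia)).
      assert (-6 <= rt 0%nat).
      { unfold rt. destruct (dec 0%nat) as [Hf|Hf]; [unfold free in Hf; lia|].
        destruct (Rlt_dec (l 0%nat) (9 / 20)); lra. }
      assert (-6 <= lt (S M')).
      { unfold lt. destruct (dec (S M')) as [Hf|Hf]; [unfold free in Hf; lia|].
        destruct (Rlt_dec (l (S M' - 1)%nat) (9 / 20)); lra. }
      lra.
Qed.

(** * Construction of the test spline *)

(** For [k = 0] this is 1 on the negative side too, hence the successor exponents in the lemmas that
    look there. *)
Definition tpow (k : nat) (x : R) : R := Rmax 0 x ^ k.

Lemma tpow_pos k x : 0 <= x -> tpow k x = x ^ k.
Proof. intros H. unfold tpow. now rewrite Rmax_right. Qed.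

Lemma tpow_neg k x : x <= 0 -> tpow (S k) x = 0.
Proof. intros H. unfold tpow. rewrite Rmax_left by exact H. simpl; ring. Qed.

Lemma is_derive_tpow k x : is_derive (tpow (S (S k))) x (INR (S (S k)) * tpow (S k) x).
Proof.
  destruct (Rtotal_order x 0) as [H|[H|H]].
  - rewrite tpow_neg by lra. rewrite Rmult_0_r.
    apply is_derive_ext_loc with (fun _ => 0); [|auto_derive; [exact I|ring]].
    exists (mkposreal (- x) ltac:(lra)). intros y Hy. unfold ball in Hy; simpl in Hy.
    unfold AbsRing_ball, abs, minus, plus, opp in Hy; simpl in Hy.
    apply Rabs_def2 in Hy. symmetry; apply tpow_neg; lra.
  - subst x. rewrite tpow_neg by lra. rewrite Rmult_0_r. apply is_derive_Reals.
    intros eps He. exists (mkposreal (Rmin 1 eps) ltac:(apply Rmin_glb_lt; lra)).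
    intros h Hh Hlt. simpl in Hlt.
    pose proof (Rmin_l 1 eps). pose proof (Rmin_r 1 eps).
    rewrite Rplus_0_l, (tpow_neg (S k) 0) by lra. rewrite !Rminus_0_r.
    destruct (Rle_dec h 0) as [Hn|Hn].
    + rewrite tpow_neg by exact Hn. unfold Rdiv. rewrite Rmult_0_l, Rabs_R0. lra.
    + rewrite tpow_pos by lra. rewrite Rabs_pos_eq in Hlt by lra.
      replace (h ^ S (S k) / h) with (h * h ^ k) by (simpl; field; lra).
      assert (0 <= h ^ k <= 1).
      { split; [apply pow_le; lra|]. rewrite <- (pow1 k). apply pow_incr; lra. }
      rewrite Rabs_pos_eq by (apply Rmult_le_pos; lra). nra.
  - rewrite tpow_pos by lra.
    apply is_derive_ext_loc with (fun y => y ^ S (S k)).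
    + exists (mkposreal x H). intros y Hy. unfold ball in Hy; simpl in Hy.
      unfold AbsRing_ball, abs, minus, plus, opp in Hy; simpl in Hy.
      apply Rabs_def2 in Hy. symmetry; apply tpow_pos; lra.
    + auto_derive; [exact I|]. simpl. ring.
Qed.

Lemma is_derive_tpow_shift k p x :
  is_derive (fun x => tpow (S (S k)) (x - p)) x (INR (S (S k)) * tpow (S k) (x - p)).
Proof.
  evar_last.
  - apply (is_derive_comp (tpow (S (S k))) (fun x => x - p)).
    + apply is_derive_tpow.
    + auto_derive; [exact I|reflexivity].
  - unfold scal; simpl; unfold Hierarchy.mult; simpl. ring.
Qed.

Lemma continuous_tpow_shift k p x : continuous (fun x => tpow (S k) (x - p)) x.
Proof.
  apply continuity_pt_filterlim. unfold tpow.
  apply continuity_pt_ext with (fun x => ((0 + (x - p) + Rabs (0 - (x - p))) / 2) ^ S k).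
  { intros y. f_equal. unfold Rabs. destruct (Rcase_abs _).
    - rewrite Rmax_right; lra.
    - rewrite Rmax_left; lra. }
  apply continuity_pt_filterlim.
  apply (continuous_comp (fun x => (0 + (x - p) + Rabs (0 - (x - p))) / 2) (fun y => y ^ S k)).
  - unfold Rdiv. apply (continuous_mult (fun x => 0 + (x - p) + Rabs (0 - (x - p))) (fun _ => / 2)).
    + apply (continuous_plus (fun x => 0 + (x - p)) (fun x => Rabs (0 - (x - p)))).
      * apply (ex_derive_continuous (fun x => 0 + (x - p))). auto_derive; exact I.
      * apply (continuous_comp (fun x => 0 - (x - p)) Rabs); [|apply continuous_Rabs].
        apply (ex_derive_continuous (fun x => 0 - (x - p))). auto_derive; exact I.
    + apply continuous_const.
  - apply (ex_derive_continuous (fun y => y ^ S k)). auto_derive; exact I.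
Qed.

Lemma is_RInt_tpow k p L : 0 <= p <= L ->
  is_RInt (fun x => tpow (S k) (x - p)) 0 L ((L - p) ^ S (S k) / INR (S (S k))).
Proof.
  intros Hp.
  assert (Hn : INR (S (S k)) <> 0) by (apply not_0_INR; lia).
  evar_last.
  - apply (is_RInt_derive (fun x => / INR (S (S k)) * tpow (S (S k)) (x - p))).
    + intros x _. evar_last.
      * apply (is_derive_scal (fun x => tpow (S (S k)) (x - p))), is_derive_tpow_shift.
      * change (/ INR (S (S k)) * (INR (S (S k)) * tpow (S k) (x - p)) = tpow (S k) (x - p)).
        now field.
    + intros x _. apply continuous_tpow_shift.
  - unfold minus, plus, opp; simpl plus.
    rewrite tpow_pos, tpow_neg by lra. unfold Rdiv. simpl Hierarchy.opp. simpl. ring.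
Qed.

Lemma knot_jump_bounds l v w : 0 <= l -> 0 <= v -> 0 <= w ->
  0 <= knot l v w <= l /\ 0 <= jump l v w.
Proof.
  intros Hl Hv Hw. unfold knot, jump. cbv zeta.
  destruct Hl as [Hl|<-]; [|lra].
  pose proof (div_sq_nonneg l v Hl Hv). pose proof (div_sq_nonneg l w Hl Hw).
  set (x := v / (2 * l ^ 2)) in *. set (y := w / (2 * l ^ 2)) in *.
  assert (0 <= (1 + y) / (1 + x + (1 + y)) <= 1).
  { split; [apply le_div|apply div_le]; lra. }
  assert (0 <= (1 + x + (1 + y)) ^ 3 / (12 * ((1 + x) * (1 + y)))).
  { apply le_div; [nra|]. rewrite Rmult_0_l. apply pow_le; lra. }
  repeat split; nra.
Qed.

(** The expansion from the left end, carried past the knot, is the expansion about the right end;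
    [jet], [knot] and [jump] solve the equations of orders 0 to 2 in [z]. Length 0 occurs when a
    node is an end point of the interval. *)
Lemma cell_step l v w z : 0 <= l -> 0 <= v -> 0 <= w -> (l = 0 -> v = 0 /\ w = 0) ->
  - (v / 24) * (l + z) ^ 2 / 2 + jet l v w / 12 * (l + z) ^ 3 / 6 + (l + z) ^ 4 / 24
    - jump l v w * (l + z - knot l v w) ^ 3 / 6
  = - (w / 24) * z ^ 2 / 2 + - (jet l w v / 12) * z ^ 3 / 6 + z ^ 4 / 24.
Proof.
  intros Hl Hv Hw H0. unfold jet, jump, knot. cbv zeta.
  destruct Hl as [Hl|<-].
  - field. repeat split; nra.
  - destruct (H0 eq_refl) as [-> ->]. rewrite !Rmult_0_l. field.
Qed.

(** The integrated form of [cell_step]: the last bracket belongs to the continuation over a further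
    length [L], so the rest is the share of the cell. *)
Lemma cell_integral l v w L : 0 <= l -> 0 <= v -> 0 <= w -> (l = 0 -> v = 0 /\ w = 0) ->
  - (v / 24) * (l + L) ^ 3 / 6 + jet l v w / 12 * (l + L) ^ 4 / 24 + (l + L) ^ 5 / 120
    - jump l v w * (l + L - knot l v w) ^ 4 / 24
  = - cost l v w / 5760
    + (- (w / 24) * L ^ 3 / 6 + - (jet l w v / 12) * L ^ 4 / 24 + L ^ 5 / 120).
Proof.
  intros Hl Hv Hw H0. unfold jet, jump, knot, cost. cbv zeta.
  destruct Hl as [Hl|<-].
  - field. repeat split; nra.
  - destruct (H0 eq_refl) as [-> ->]. rewrite !Rmult_0_l.
    replace (0 ^ 5) with 0 by ring. rewrite !Rmult_0_r, Rmult_0_l. field.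
Qed.

Lemma is_RInt_sub_tpow F I0 b p L : is_RInt F 0 L I0 -> 0 <= p <= L ->
  is_RInt (fun x => F x - b * tpow 3 (x - p)) 0 L (I0 - b * ((L - p) ^ 4 / 4)).
Proof.
  intros HF Hp.
  apply (is_RInt_minus F (fun x => b * tpow 3 (x - p))); [exact HF|].
  apply (is_RInt_scal (fun x => tpow 3 (x - p))).
  replace 4 with (INR 4) by (simpl; ring). now apply (is_RInt_tpow 2).
Qed.

(** [Lam] stands for the rescaled remainder. From a quartic, truncated cubes are subtracted at the
    nodes and knots from left to right. Each subtraction can only increase [Lam], and once all nodes
    are zeros [Lam] is the integral. *)
Lemma monospline_bound (M : nat) (y l v : nat -> R) (Lam : (R -> R) -> R) (W : R) :
  (1 <= M)%nat -> y 0%nat = 0 ->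
  (forall i, y (S i) = y i + l i) -> (forall i, 0 <= l i) ->
  (forall i, 0 <= v i) -> v 0%nat = 0 ->
  (forall i, (i < M)%nat -> l i = 0 -> v i = 0 /\ v (i + 1)%nat = 0) ->
  (forall i, (1 <= i < M)%nat ->
       jet (l i) (v i) (v (i + 1)%nat) + jet (l (i - 1)%nat) (v i) (v (i - 1)%nat) <= 0) ->
  (forall F b p, (forall x, continuous F x) -> 0 <= b -> 0 <= p <= y M ->
     Lam F <= Lam (fun x => F x - b * tpow 3 (x - p))) ->
  (forall q, W <= Lam (fun x => q * x ^ 3 + x ^ 4 / 24)) ->
  (forall F I0, (forall x, continuous F x) -> (forall i, (i <= M)%nat -> F (y i) = 0) ->
     is_RInt F 0 (y M) I0 -> Lam F = I0) ->
  W <= - psum (fun i => cost (l i) (v i) (v (i + 1)%nat)) M / 5760.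
Proof.
  intros HM Hy0 Hy Hl Hv Hv0 Hlz Hjet Htp HW Hint.
  assert (Hmon : forall i j, (i <= j)%nat -> y i <= y j).
  { intros i j H. induction H as [|j H IH]; [lra|]. rewrite Hy. pose proof (Hl j). lra. }
  (* [F] is finished on the first [k] cells and continues as a quartic with third derivative [q] at
     [y k]; by the last clause [q] only has to drop to suit the next cell. *)
  assert (Key : forall k, (k <= M)%nat -> exists (F : R -> R) (q I0 : R),
    (forall x, continuous F x) /\ W <= Lam F /\ (forall i, (i <= k)%nat -> F (y i) = 0) /\
    (forall z, 0 <= z ->
       F (y k + z) = - (v k / 24) * z ^ 2 / 2 + q * z ^ 3 / 6 + z ^ 4 / 24) /\
    is_RInt F 0 (y M) I0 /\
    (let L := y M - y k in
     I0 = - psum (fun i => cost (l i) (v i) (v (i + 1)%nat)) k / 5760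
       + (- (v k / 24) * L ^ 3 / 6 + q * L ^ 4 / 24 + L ^ 5 / 120)) /\
    ((k < M)%nat -> jet (l k) (v k) (v (k + 1)%nat) / 12 <= q)).
  { induction k as [|k IH]; intros Hk.
    (* [HW] allows every cubic term, so the third derivative at 0 can be fitted to the first
       cell. *)
    - set (q := jet (l 0%nat) (v 0%nat) (v 1%nat) / 12).
      exists (fun x => q / 6 * x ^ 3 + x ^ 4 / 24), q, (q * y M ^ 4 / 24 + y M ^ 5 / 120).
      split; [|split; [|split; [|split; [|split; [|split]]]]].
      + intros x. apply (ex_derive_continuous (fun x => q / 6 * x ^ 3 + x ^ 4 / 24)).
        auto_derive; exact I.
      + apply HW.
      + intros i Hi. replace i with 0%nat by lia. rewrite Hy0. field.
      + intros z Hz. rewrite Hy0, Hv0. field.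
      + evar_last.
        * apply (is_RInt_derive (fun x => q * x ^ 4 / 24 + x ^ 5 / 120)).
          -- intros x _. auto_derive; [exact I|]. field.
          -- intros x _. apply (ex_derive_continuous (fun x => q / 6 * x ^ 3 + x ^ 4 / 24)).
             auto_derive; exact I.
        * unfold minus, plus, opp; simpl. field.
      + simpl. rewrite Hy0, Hv0. field.
      + intros _. simpl. fold q. lra.
    - destruct (IH ltac:(lia)) as (F & q & I0 & Hc & HWF & Hz & Hloc & HI & HI0 & Hq).
      specialize (Hq ltac:(lia)).
      set (q' := jet (l k) (v k) (v (k + 1)%nat) / 12) in *.
      set (p := y k + knot (l k) (v k) (v (k + 1)%nat)).
      set (b := jump (l k) (v k) (v (k + 1)%nat)).
      destruct (knot_jump_bounds (l k) (v k) (v (k + 1)%nat) (Hl k) (Hv k) (Hv _)) as [Hkn Hb].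
      fold b in Hb.
      assert (Hyk : 0 <= y k) by (rewrite <- Hy0; apply Hmon; lia).
      assert (HyM : y k + l k <= y M) by (rewrite <- Hy; apply Hmon; lia).
      pose proof (Hlz k ltac:(lia)) as Hlzk.
      pose proof (Hl k) as Hlk.
      (* [F1] resets the third derivative at the node from [q] to [q']; the second correction acts
         at the knot. *)
      set (F1 := fun x => F x - (q - q') / 6 * tpow 3 (x - y k)).
      assert (Hc1 : forall x, continuous F1 x).
      { intros x. apply (continuous_minus F); [apply Hc|].
        apply (continuous_scal_r ((q - q') / 6) (fun x => tpow 3 (x - y k))), continuous_tpow_shift. }
      exists (fun x => F1 x - b / 6 * tpow 3 (x - p)),
             (- (jet (l k) (v (k + 1)%nat) (v k) / 12)),
             (I0 - (q - q') / 6 * ((y M - y k) ^ 4 / 4) - b / 6 * ((y M - p) ^ 4 / 4)).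
      assert (Hloc' : forall z, 0 <= z -> F1 (y (S k) + z) - b / 6 * tpow 3 (y (S k) + z - p) =
         - (v (S k) / 24) * z ^ 2 / 2 + - (jet (l k) (v (k + 1)%nat) (v k) / 12) * z ^ 3 / 6
           + z ^ 4 / 24).
      { intros z Hz0. rewrite Hy. unfold F1.
        replace (y k + l k + z) with (y k + (l k + z)) by ring.
        rewrite Hloc by lra. rewrite !tpow_pos by (unfold p; lra).
        replace (S k) with (k + 1)%nat by lia.
        rewrite <- cell_step; auto. fold q' b. unfold p. field. }
      split; [|split; [|split; [|split; [|split; [|split]]]]].
      + intros x. apply (continuous_minus F1); [apply Hc1|].
        apply (continuous_scal_r (b / 6) (fun x => tpow 3 (x - p))), continuous_tpow_shift.
      + eapply Rle_trans; [exact HWF|]. eapply Rle_trans.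
        * apply (Htp F ((q - q') / 6) (y k)); [exact Hc|lra|lra].
        * apply Htp; [exact Hc1|lra|unfold p; lra].
      + intros i Hi. destruct (Nat.eq_dec i (S k)) as [->|Hne].
        * replace (y (S k)) with (y (S k) + 0) by ring. rewrite Hloc' by lra. field.
        * assert (y i <= y k) by (apply Hmon; lia).
          unfold F1. rewrite !tpow_neg by (unfold p; lra). rewrite Hz by lia. ring.
      + exact Hloc'.
      + apply is_RInt_sub_tpow; [apply is_RInt_sub_tpow; [exact HI|lra]|unfold p; lra].
      + cbv zeta in *. rewrite HI0. simpl psum.
        pose proof (cell_integral (l k) (v k) (v (k + 1)%nat) (y M - y (S k)) Hlk (Hv _) (Hv _) Hlzk) as X.
        rewrite Hy in X |- *. fold q' b in X.
        replace (l k + (y M - (y k + l k))) with (y M - y k) in X by ring.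
        replace (y M - y k - knot (l k) (v k) (v (k + 1)%nat)) with (y M - p) in X by (unfold p; ring).
        replace (v (S k)) with (v (k + 1)%nat) by (f_equal; lia).
        lra.
      + intros Hk'. pose proof (Hjet (S k) ltac:(lia)) as X.
        replace (S k - 1)%nat with k in X by lia.
        replace (v (S k)) with (v (k + 1)%nat) in X |- * by (f_equal; lia). lra. }
  destruct (Key M ltac:(lia)) as (F & q & I0 & Hc & HWF & Hz & _ & HI & HI0 & _).
  rewrite (Hint F I0 Hc Hz HI) in HWF. cbv zeta in HI0.
  replace (y M - y M) with 0 in HI0 by ring. lra.
Qed.

(** * The bound for an arbitrary negative definite formula *)

Lemma is_derive_D_in f g D x : is_derive f x (g x) -> D_in f g D x.
Proof.
  intros H. apply is_derive_Reals, derivable_pt_lim_D_in in H.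
  intros eps He. destruct (H eps He) as (d & Hd & Hn). exists d. split; [exact Hd|].
  intros z [[_ Hz] Hdz]. apply Hn. split; [split; [exact I|exact Hz]|exact Hdz].
Qed.

Lemma continuous_continue_in f D x : continuous f x -> continue_in f D x.
Proof.
  intros H. apply continuity_pt_filterlim in H.
  intros eps He. destruct (H eps He) as (d & Hd & Hn). exists d. split; [exact Hd|].
  intros z [[_ Hz] Hdz]. apply Hn. split; [split; [exact I|exact Hz]|exact Hdz].
Qed.

Lemma C_with_derivs_intro r f (d : nat -> R -> R) :
  (forall x, d 0%nat x = f x) ->
  (forall k x, (k < r)%nat -> is_derive (d k) x (d (S k) x)) ->
  (forall x, continuous (d r) x) -> C_with_derivs r f d.
Proof.
  intros H0 H1 H2. split; [|split].
  - intros x _. apply H0.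
  - intros k x Hk _. now apply is_derive_D_in, H1.
  - intros x _. now apply continuous_continue_in.
Qed.

Lemma Q_linear N Q f g b : is_quadrature N Q ->
  Q (fun x => f x - b * g x) = Q f - b * Q g.
Proof.
  intros (a & tau & _ & _ & HQ). rewrite !HQ.
  assert (X : forall n, sum_n_m (fun i => a i * (f (tau i) - b * g (tau i))) 1 n
     = sum_n_m (fun i => a i * f (tau i)) 1 n - b * sum_n_m (fun i => a i * g (tau i)) 1 n).
  { induction n as [|n IH].
    - rewrite !sum_n_m_zero by lia. unfold zero; simpl. ring.
    - rewrite !sum_n_Sm by lia. rewrite IH. unfold plus; simpl. ring. }
  apply X.
Qed.

Lemma remainder_linear N Q f g b : is_quadrature N Q ->
  (forall x, continuous f x) -> (forall x, continuous g x) ->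
  remainder Q (fun x => f x - b * g x) = remainder Q f - b * remainder Q g.
Proof.
  intros HQ Hf Hg. unfold remainder. rewrite (Q_linear N) by exact HQ.
  assert (ex_RInt f 0 1) by (apply (ex_RInt_continuous f); intros; apply Hf).
  assert (ex_RInt g 0 1) by (apply (ex_RInt_continuous g); intros; apply Hg).
  assert (X : RInt (fun x => f x - b * g x) 0 1 = RInt f 0 1 - b * RInt g 0 1).
  { apply is_RInt_unique. apply (is_RInt_minus f (fun x => b * g x)).
    - now apply (RInt_correct f).
    - apply (is_RInt_scal g). now apply (RInt_correct g). }
  rewrite X. ring.
Qed.

(** Continuity in the uniform norm, for the passage from smooth functions to the truncated cube. *)
Lemma remainder_bounded N Q : is_quadrature N Q -> exists C, 0 <= C /\
  forall h e, (forall x, continuous h x) -> 0 <= e -> (forall x, 0 <= x <= 1 -> Rabs (h x) <= e) ->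
  Rabs (remainder Q h) <= C * e.
Proof.
  intros (a & tau & Ht & _ & HQ).
  assert (X : forall n, (n <= N)%nat -> exists C, 0 <= C /\ forall h e, 0 <= e ->
     (forall x, 0 <= x <= 1 -> Rabs (h x) <= e) ->
     Rabs (sum_n_m (fun i => a i * h (tau i)) 1 n) <= C * e).
  { induction n as [|n IH]; intros Hn.
    - exists 0. split; [lra|]. intros h e He _. rewrite sum_n_m_zero by lia.
      unfold zero; simpl. rewrite Rabs_R0. lra.
    - destruct (IH ltac:(lia)) as (C & HC & HCb).
      exists (C + Rabs (a (S n))). pose proof (Rabs_pos (a (S n))). split; [lra|].
      intros h e He Hh. rewrite sum_n_Sm by lia. unfold plus; simpl.
      eapply Rle_trans; [apply Rabs_triang|]. rewrite Rabs_mult.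
      specialize (HCb h e He Hh). specialize (Hh (tau (S n)) (Ht (S n) ltac:(lia))).
      pose proof (Rabs_pos (h (tau (S n)))). nra. }
  destruct (X N ltac:(lia)) as (C & HC & HCb).
  exists (1 + C). split; [lra|]. intros h e Hc He Hh. unfold remainder, Rminus.
  eapply Rle_trans; [apply Rabs_triang|]. rewrite Rabs_Ropp, HQ.
  specialize (HCb h e He Hh).
  assert (Rabs (RInt h 0 1) <= (1 - 0) * e).
  { apply abs_RInt_le_const; [lra| |exact Hh].
    apply (ex_RInt_continuous h); intros; apply Hc. }
  lra.
Qed.

(** At distance at least [e] from the kink the error is exactly [10 * y * e ^ 4] or 0; closer to it
    every term is of order [e ^ 5]. *)
Lemma tpow5_second_difference y e : 0 < e <= 1 -> Rabs y <= 1 ->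
  Rabs (tpow 5 (y + e) - 2 * tpow 5 y + tpow 5 (y - e) - 20 * e ^ 2 * tpow 3 y) <= 100 * e ^ 4.
Proof.
  intros He Hy. apply Rabs_le_between in Hy.
  assert (H4 : 0 <= e ^ 4) by (apply pow_le; lra).
  assert (Hlow : forall k z, z <= e -> 0 <= tpow k z <= e ^ k).
  { intros k z Hz. unfold tpow. pose proof (Rmax_l 0 z). split; [now apply pow_le|].
    apply pow_incr. split; [assumption|]. apply Rmax_lub; lra. }
  destruct (Rle_dec e y) as [H1|H1]; [|destruct (Rle_dec y (- e)) as [H2|H2]].
  - rewrite !tpow_pos by lra.
    replace ((y + e) ^ 5 - 2 * y ^ 5 + (y - e) ^ 5 - 20 * e ^ 2 * y ^ 3) with (10 * y * e ^ 4) by ring.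
    rewrite Rabs_pos_eq; nra.
  - rewrite (tpow_neg 4 (y + e)), (tpow_neg 4 y), (tpow_neg 4 (y - e)), (tpow_neg 2 y) by lra.
    replace (0 - 2 * 0 + 0 - 20 * e ^ 2 * 0) with 0 by ring. rewrite Rabs_R0. lra.
  - rewrite (tpow_neg 4 (y - e)) by lra.
    assert (0 <= tpow 5 (y + e) <= 32 * e ^ 5).
    { unfold tpow. pose proof (Rmax_l 0 (y + e)). split; [now apply pow_le|].
      replace (32 * e ^ 5) with ((2 * e) ^ 5) by ring.
      apply pow_incr. split; [assumption|]. apply Rmax_lub; lra. }
    pose proof (Hlow 5%nat y ltac:(lra)). pose proof (Hlow 3%nat y ltac:(lra)).
    assert (H5 : 0 <= e ^ 5 <= e ^ 4).
    { replace (e ^ 5) with (e * e ^ 4) by ring. nra. }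
    assert (0 <= e ^ 2 * tpow 3 y <= e ^ 5).
    { assert (0 < e ^ 2) by (apply pow_lt; lra).
      replace (e ^ 5) with (e ^ 2 * e ^ 3) by ring. nra. }
    apply Rabs_le. lra.
Qed.

Definition tpow_diff2 k p e x :=
  tpow k (x - (p - e)) - 2 * tpow k (x - p) + tpow k (x - (p + e)).

Lemma is_derive_tpow_diff2 k p e x :
  is_derive (tpow_diff2 (S (S k)) p e) x (INR (S (S k)) * tpow_diff2 (S k) p e x).
Proof.
  unfold tpow_diff2. evar_last.
  - apply (is_derive_plus (fun x => tpow (S (S k)) (x - (p - e)) - 2 * tpow (S (S k)) (x - p))
      (fun x => tpow (S (S k)) (x - (p + e)))); [|apply is_derive_tpow_shift].
    apply (is_derive_minus (fun x => tpow (S (S k)) (x - (p - e))) (fun x => 2 * tpow (S (S k)) (x - p)));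
      [apply is_derive_tpow_shift|].
    apply (is_derive_scal (fun x => tpow (S (S k)) (x - p))), is_derive_tpow_shift.
  - unfold minus, plus, opp; cbn -[INR]. ring.
Qed.

Lemma continuous_tpow_diff2 k p e x : continuous (tpow_diff2 (S k) p e) x.
Proof.
  unfold tpow_diff2.
  apply (continuous_plus (fun x => tpow (S k) (x - (p - e)) - 2 * tpow (S k) (x - p))
      (fun x => tpow (S k) (x - (p + e)))); [|apply continuous_tpow_shift].
  apply (continuous_minus (fun x => tpow (S k) (x - (p - e))) (fun x => 2 * tpow (S k) (x - p)));
    [apply continuous_tpow_shift|].
  apply (continuous_scal_r 2 (fun x => tpow (S k) (x - p))), continuous_tpow_shift.
Qed.

(** This is the hat function of height [e] on the interval from [p - e] to [p + e]; up to the factor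
    120 it is the fourth derivative of [tpow_diff2 5 p e]. *)
Lemma tpow1_diff2_nonneg p e x : 0 <= e -> 0 <= tpow_diff2 1 p e x.
Proof.
  intros He. unfold tpow_diff2, tpow, Rmax. rewrite !pow_1.
  repeat destruct Rle_dec; lra.
Qed.

(* The truncated cube is not of class C^4, but it is a uniform limit of C^4
   functions with nonnegative fourth derivative. *)
Lemma remainder_tpow3_nonpos N Q c p : is_quadrature N Q -> negative_definite4 Q c ->
  0 <= p <= 1 -> remainder Q (fun x => tpow 3 (x - p)) <= 0.
Proof.
  intros HQ [Hc HD] Hp. destruct (remainder_bounded N Q HQ) as (C & HC & HB).
  set (r := remainder Q (fun x => tpow 3 (x - p))).
  assert (X : forall e, 0 < e <= 1 -> 20 * r <= C * 100 * e ^ 2).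
  { intros e He.
    assert (Hf : remainder Q (tpow_diff2 5 p e) <= 0).
    { destruct (HD (tpow_diff2 5 p e) (fun k => match k with
        | 0%nat => tpow_diff2 5 p e
        | 1%nat => fun x => 5 * tpow_diff2 4 p e x
        | 2%nat => fun x => 20 * tpow_diff2 3 p e x
        | 3%nat => fun x => 60 * tpow_diff2 2 p e x
        | _ => fun x => 120 * tpow_diff2 1 p e x end)) as (xi & _ & ->).
      - apply C_with_derivs_intro; [reflexivity| |].
        + intros k x Hk.
          assert (Hs : forall b j, is_derive (fun x => b * tpow_diff2 (S (S j)) p e x) x
             (b * (INR (S (S j)) * tpow_diff2 (S j) p e x))).
          { intros b j. apply (is_derive_scal (tpow_diff2 (S (S j)) p e)), is_derive_tpow_diff2. }
          destruct k as [|[|[|[|k]]]]; [| | | |lia].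
          * replace (5 * tpow_diff2 4 p e x) with (INR 5 * tpow_diff2 4 p e x) by (simpl; ring).
            apply is_derive_tpow_diff2.
          * replace (20 * tpow_diff2 3 p e x) with (5 * (INR 4 * tpow_diff2 3 p e x)) by (simpl; ring).
            apply Hs.
          * replace (60 * tpow_diff2 2 p e x) with (20 * (INR 3 * tpow_diff2 2 p e x)) by (simpl; ring).
            apply Hs.
          * replace (120 * tpow_diff2 1 p e x) with (60 * (INR 2 * tpow_diff2 1 p e x)) by (simpl; ring).
            apply Hs.
        + intros x. apply (continuous_scal_r 120 (tpow_diff2 1 p e)), continuous_tpow_diff2.
      - pose proof (tpow1_diff2_nonneg p e xi ltac:(lra)). nra. }
    pose proof (HB (fun x => tpow_diff2 5 p e x - 20 * e ^ 2 * tpow 3 (x - p)) (100 * e ^ 4)) as Y.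
    assert (0 <= e ^ 4) by (apply pow_le; lra).
    rewrite (remainder_linear N) in Y;
      [|exact HQ|intros; apply continuous_tpow_diff2|intros; apply continuous_tpow_shift].
    fold r in Y.
    assert (Z : Rabs (remainder Q (tpow_diff2 5 p e) - 20 * e ^ 2 * r) <= C * (100 * e ^ 4)).
    { apply Y; [|lra|].
      - intros x. apply (continuous_minus (tpow_diff2 5 p e)); [apply continuous_tpow_diff2|].
        apply (continuous_scal_r (20 * e ^ 2) (fun x => tpow 3 (x - p))), continuous_tpow_shift.
      - intros x Hx. unfold tpow_diff2.
        replace (x - (p - e)) with (x - p + e) by ring. replace (x - (p + e)) with (x - p - e) by ring.
        apply tpow5_second_difference; [exact He|]. apply Rabs_le; lra. }
    apply Rabs_le_between in Z.
    assert (0 < e ^ 2) by (apply pow_lt; lra).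
    apply Rmult_le_reg_l with (e ^ 2); [assumption|].
    replace (e ^ 2 * (C * 100 * e ^ 2)) with (C * (100 * e ^ 4)) by ring. lra. }
  apply Rnot_lt_le. intros Hr.
  assert (exists e, 0 < e <= 1 /\ C * 100 * e ^ 2 < 20 * r) as (e & He & Hlt).
  (* As [e <= 1], this choice gives [100 * C * e ^ 2 <= 10 * (10 * C + 1) * e <= 10 * r]. *)
  { exists (Rmin 1 (r / (10 * C + 1))).
    assert (0 < r / (10 * C + 1)) by (apply Rdiv_lt_0_compat; lra).
    assert (H0 : 0 < Rmin 1 (r / (10 * C + 1))) by (apply Rmin_glb_lt; lra).
    pose proof (Rmin_l 1 (r / (10 * C + 1))). pose proof (Rmin_r 1 (r / (10 * C + 1))) as Hmin.
    split; [lra|].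
    set (e := Rmin 1 (r / (10 * C + 1))) in *.
    assert (e * (10 * C + 1) <= r).
    { replace r with (r / (10 * C + 1) * (10 * C + 1)) by (field; lra).
      apply Rmult_le_compat_r; lra. }
    assert (e ^ 2 <= e) by nra.
    nra. }
  specialize (X e He). lra.
Qed.

Lemma psum_lengths (y : nat -> R) M :
  psum (fun i => 35 * (y (S i) - y i) - 28) M = 35 * (y M - y 0%nat) - 28 * INR M.
Proof. induction M as [|M IH]; [simpl; ring|]. rewrite S_INR. simpl psum. rewrite IH. ring. Qed.

Lemma remainder_quartic Q c q3 q4 : negative_definite4 Q c ->
  remainder Q (fun x => q3 * x ^ 3 + q4 * x ^ 4) = c * (24 * q4).
Proof.
  intros [_ HD].
  destruct (HD (fun x => q3 * x ^ 3 + q4 * x ^ 4) (fun k => match k with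
        | 0%nat => fun x => q3 * x ^ 3 + q4 * x ^ 4
        | 1%nat => fun x => 3 * q3 * x ^ 2 + 4 * q4 * x ^ 3
        | 2%nat => fun x => 6 * q3 * x + 12 * q4 * x ^ 2
        | 3%nat => fun x => 6 * q3 + 24 * q4 * x
        | _ => fun x => 24 * q4 end)) as (xi & _ & ->).
  - apply C_with_derivs_intro; [reflexivity| |].
    + intros k x Hk.
      destruct k as [|[|[|[|k]]]]; [| | | |lia]; auto_derive; try exact I; ring.
    + intros x. apply continuous_const.
  - reflexivity.
Qed.

Lemma continuous_scaled (F : R -> R) m x : (forall x, continuous F x) -> continuous (fun x => F (m * x)) x.
Proof.
  intros HF. apply (continuous_comp (fun x => m * x) F); [|apply HF].
  apply (ex_derive_continuous (fun x => m * x)). auto_derive; exact I.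
Qed.

Lemma tpow_scale k m p x : 0 < m -> tpow k (m * x - p) = m ^ k * tpow k (x - p / m).
Proof.
  intros Hm. unfold tpow. rewrite <- Rpow_mult_distr. f_equal.
  rewrite <- RmaxRmult by lra. f_equal; field; lra.
Qed.

Lemma error_constant_upper N Q c : is_quadrature N Q -> negative_definite4 Q c ->
  c <= - 7 / (5760 * INR (N + 1) ^ 4) + 12 / (5760 * INR (N + 1) ^ 5).
Proof.
  intros HQ HD. pose proof HQ as (a & tau & Ht & Hinc & HQs).
  set (m := INR (N + 1)).
  assert (Hm : 1 <= m) by (unfold m; rewrite plus_INR; simpl; pose proof (pos_INR N); lra).
  (* The end points are added to the scaled nodes; if one of them is a node already, a cell of
     length 0 arises. *)
  set (y := fun i => if Nat.eq_dec i 0 then 0 else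
     if Compare_dec.le_dec i N then m * tau i else m).
  set (l := fun i => y (S i) - y i).
  assert (Hl : forall i, 0 <= l i).
  { intros i. unfold l, y. destruct (Nat.eq_dec (S i) 0) as [H0|H0]; [lia|].
    destruct (Nat.eq_dec i 0); destruct (Compare_dec.le_dec (S i) N);
      try (destruct (Compare_dec.le_dec i N)); try lia; try lra.
    - destruct (Ht (S i) ltac:(lia)). nra.
    - pose proof (Hinc i (S i) ltac:(lia) ltac:(lia) ltac:(lia)). nra.
    - destruct (Ht i ltac:(lia)). nra. }
  assert (Hy0 : y 0%nat = 0) by reflexivity.
  assert (HyM : y (N + 1)%nat = m).
  { unfold y. destruct (Nat.eq_dec (N + 1) 0); [lia|].
    destruct (Compare_dec.le_dec (N + 1) N); [lia|reflexivity]. }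
  destruct (node_values (N + 1) l ltac:(lia) Hl) as (v & Hv & Hv0 & _ & Hshort & Hjet & Hcost).
  (* The factor [m] makes the integral part that of [F] over the interval from 0 to [m]; the quartic
     [x ^ 4 / 24] then gets the value [m ^ 5 * c]. *)
  pose proof (monospline_bound (N + 1) y l v
    (fun F => m * remainder Q (fun x => F (m * x))) (m ^ 5 * c)) as B.
  assert (X : m ^ 5 * c <= - psum (fun i => cost (l i) (v i) (v (i + 1)%nat)) (N + 1) / 5760).
  { apply B; clear B; auto.
    - lia.
    - intros i. unfold l. ring.
    - intros i. apply Hv.
    - intros i Hi Hi0. apply Hshort; [exact Hi|lra].
    - intros F b p HF Hb Hp. rewrite HyM in Hp.
      apply Rmult_le_compat_l; [lra|].
      assert (E : remainder Q (fun x => F (m * x) - b * tpow 3 (m * x - p))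
         = remainder Q (fun x => F (m * x) - b * m ^ 3 * tpow 3 (x - p / m))).
      { f_equal. apply functional_extensionality. intros x. rewrite tpow_scale by lra. ring. }
      rewrite E, (remainder_linear N);
        [|exact HQ|intros; now apply continuous_scaled|intros; apply continuous_tpow_shift].
      assert (Hpm : 0 <= p / m <= 1) by (split; [apply le_div|apply div_le]; lra).
      pose proof (remainder_tpow3_nonpos N Q c (p / m) HQ HD Hpm).
      assert (0 <= b * m ^ 3) by (apply Rmult_le_pos; [lra|apply pow_le; lra]). nra.
    - intros q. right.
      assert (E : remainder Q (fun x => q * (m * x) ^ 3 + (m * x) ^ 4 / 24)
        = remainder Q (fun x => q * m ^ 3 * x ^ 3 + m ^ 4 / 24 * x ^ 4)).
      { f_equal. apply functional_extensionality. intros x. field. }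
      rewrite E, (remainder_quartic Q c) by exact HD. field.
    - intros F I0 HF Hz HI. rewrite HyM in HI.
      assert (E : Q (fun x => F (m * x)) = 0).
      { rewrite HQs.
        assert (Z : forall n, (n <= N)%nat -> sum_n_m (fun i => a i * F (m * tau i)) 1 n = 0).
        { induction n as [|n IH]; intros Hn.
          - now rewrite sum_n_m_zero by lia.
          - rewrite sum_n_Sm by lia. rewrite IH by lia. unfold plus; simpl.
            specialize (Hz (S n) ltac:(lia)). unfold y in Hz.
            destruct (Nat.eq_dec (S n) 0); [lia|].
            destruct (Compare_dec.le_dec (S n) N); [|lia]. rewrite Hz. ring. }
        now apply Z. }
      unfold remainder. rewrite E, Rminus_0_r.
      assert (R1 : is_RInt (fun x => scal m (F (m * x + 0))) 0 1 I0).
      { apply (is_RInt_comp_lin F). now rewrite Rmult_0_r, Rplus_0_r, Rmult_1_r, Rplus_0_r. }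
      assert (R2 : is_RInt (fun x => F (m * x)) 0 1 (/ m * I0)).
      { apply is_RInt_ext with (fun x => scal (/ m) (scal m (F (m * x + 0)))).
        - intros x _. rewrite Rplus_0_r. unfold scal; simpl; unfold Hierarchy.mult; simpl. field; lra.
        - now apply (is_RInt_scal (fun x => scal m (F (m * x + 0)))). }
      rewrite (is_RInt_unique _ _ _ _ R2). field. lra. }
  (* The lengths add up to [m], so the tangents add up to [35 * m - 28 * m]. *)
  assert (Y : psum (fun i => 35 * l i - 28) (N + 1) = 7 * m).
  { unfold l. rewrite psum_lengths, HyM, Hy0. fold m. ring. }
  assert (H5 : 0 < m ^ 5) by (apply pow_lt; lra).
  apply Rmult_le_reg_l with (m ^ 5); [exact H5|].
  replace (m ^ 5 * (- 7 / (5760 * m ^ 4) + 12 / (5760 * m ^ 5)))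
    with (- (7 * m - 12) / 5760) by (field; lra).
  lra.
Qed.

(** * Definiteness of [Q5] *)

(** Composition with this projection extends functions from the unit interval to the line, where
    two-sided derivatives and integrals are available. *)
Definition clamp x := Rmax 0 (Rmin 1 x).

Lemma clamp_I01 x : I01 (clamp x).
Proof.
  unfold I01, clamp. split; [apply Rmax_l|]. apply Rmax_lub; [lra|apply Rmin_l].
Qed.

Lemma clamp_id x : I01 x -> clamp x = x.
Proof. intros [H1 H2]. unfold clamp. rewrite Rmin_right, Rmax_right; lra. Qed.

Lemma clamp_lipschitz x z : Rabs (clamp z - clamp x) <= Rabs (z - x).
Proof.
  unfold clamp, Rmax, Rmin, Rabs.
  repeat destruct Rle_dec; repeat destruct Rcase_abs; lra.
Qed.

Lemma continuous_clamp g : (forall x, I01 x -> continue_in g I01 x) ->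
  forall x, continuous (fun x => g (clamp x)) x.
Proof.
  intros Hg x. apply continuity_pt_filterlim. intros eps He.
  destruct (Hg (clamp x) (clamp_I01 x) eps He) as (d & Hd & Hn).
  exists d. split; [exact Hd|]. intros z [_ Hz].
  destruct (Req_dec (clamp z) (clamp x)) as [E|E].
  - rewrite E. unfold dist; simpl; unfold Rdist. rewrite Rminus_diag, Rabs_R0. exact He.
  - apply Hn. split; [split; [apply clamp_I01|now apply not_eq_sym]|].
    eapply Rle_lt_trans; [apply clamp_lipschitz|exact Hz].
Qed.

Lemma D_in_is_derive g g' x : 0 < x < 1 -> D_in g g' I01 x -> is_derive g x (g' x).
Proof.
  intros Hx HD. apply is_derive_Reals. apply derivable_pt_lim_D_in.
  intros eps He. destruct (HD eps He) as (d & Hd & Hn).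
  exists (Rmin d (Rmin x (1 - x))). split; [repeat apply Rmin_glb_lt; lra|].
  intros z [[_ Hz] Hdz]. apply Hn.
  pose proof (Rmin_l d (Rmin x (1 - x))). pose proof (Rmin_r d (Rmin x (1 - x))).
  pose proof (Rmin_l x (1 - x)). pose proof (Rmin_r x (1 - x)).
  split; [|simpl in *; lra]. split; [|exact Hz].
  simpl in Hdz. unfold Rdist in Hdz.
  assert (Hlt : Rabs (z - x) < Rmin x (1 - x)) by lra.
  apply Rabs_def2 in Hlt. unfold I01. lra.
Qed.

(** [G] is [g 0] plus the integral of [h]. On the interval [g - G] is constant by the mean value
    theorem, applied to the clamped [g] because [g] is only one-sidedly controlled at the ends. *)
Lemma extend_primitive g g' h :
  (forall x, I01 x -> D_in g g' I01 x) -> (forall x, I01 x -> h x = g' x) ->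
  (forall x, continuous h x) ->
  exists G, (forall x, is_derive G x (h x)) /\ (forall x, I01 x -> G x = g x).
Proof.
  intros Hg Hh Hc. set (G := fun x => g 0 + RInt h 0 x).
  assert (HG : forall x, is_derive G x (h x)).
  { intros x. unfold G. evar_last.
    - apply (is_derive_plus (fun _ => g 0) (fun x => RInt h 0 x)).
      + apply is_derive_const.
      + apply (is_derive_RInt h (fun x => RInt h 0 x) 0).
        * apply filter_forall. intros y. apply (RInt_correct h).
          apply (ex_RInt_continuous h). intros; apply Hc.
        * apply Hc.
    - apply plus_zero_l. }
  exists G. split; [exact HG|]. intros x [Hx0 Hx1].
  assert (Hgc : forall x, continuous (fun x => g (clamp x)) x).
  { apply continuous_clamp. intros z Hz. eapply cont_deriv. now apply Hg. }
  destruct (MVT_gen (fun x => g (clamp x) - G x) 0 x (fun _ => 0)) as (xi & _ & E).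
  - intros z Hz. rewrite Rmin_left, Rmax_right in Hz by lra.
    apply is_derive_ext_loc with (fun x => g x - G x).
    + exists (mkposreal (Rmin z (1 - z)) ltac:(apply Rmin_glb_lt; lra)). intros t Ht.
      unfold ball in Ht; simpl in Ht. unfold AbsRing_ball, abs, minus, plus, opp in Ht; simpl in Ht.
      pose proof (Rmin_l z (1 - z)). pose proof (Rmin_r z (1 - z)).
      apply Rabs_def2 in Ht. rewrite clamp_id by (unfold I01; lra). reflexivity.
    + evar_last.
      * apply (is_derive_minus g G); [apply (D_in_is_derive g g'); [lra|apply Hg; unfold I01; lra]|apply HG].
      * rewrite Hh by (unfold I01; lra). apply (minus_eq_zero (g' z)).
  - intros z Hz. apply continuity_pt_filterlim.
    apply (continuous_minus (fun x => g (clamp x)) G); [apply Hgc|].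
    apply (ex_derive_continuous G). eexists; apply HG.
  - cbv beta in E. rewrite !clamp_id in E by (unfold I01; lra).
    assert (E0 : G 0 = g 0) by (unfold G; rewrite RInt_point; apply Rplus_0_r). lra.
Qed.

Definition deriv_chain (e : nat -> R -> R) : Prop :=
  (forall k x, (k < 4)%nat -> is_derive (e k) x (e (S k) x)) /\ (forall x, continuous (e 4%nat) x).

(** The fourth derivative is clamped, and the lower ones are rebuilt from it by four successive
    primitives. *)
Lemma extend_C4 f d : C_with_derivs 4 f d ->
  exists e, deriv_chain e /\ (forall x, I01 x -> e 0%nat x = f x) /\
    (forall x, I01 x -> e 4%nat x = d 4%nat x).
Proof.
  intros (H0 & H1 & H2).
  set (e4 := fun x => d 4%nat (clamp x)).
  assert (C4 : forall x, continuous e4 x) by now apply continuous_clamp.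
  assert (A4 : forall x, I01 x -> e4 x = d 4%nat x) by (intros x Hx; unfold e4; now rewrite clamp_id).
  assert (Cd : forall F f : R -> R, (forall x, is_derive F x (f x)) -> forall x, continuous F x).
  { intros F f' HF x. apply (ex_derive_continuous F). eexists; apply HF. }
  destruct (extend_primitive (d 3%nat) (d 4%nat) e4) as (e3 & D3 & A3); auto.
  destruct (extend_primitive (d 2%nat) (d 3%nat) e3) as (e2 & D2 & A2); eauto.
  destruct (extend_primitive (d 1%nat) (d 2%nat) e2) as (e1 & D1 & A1); eauto.
  destruct (extend_primitive (d 0%nat) (d 1%nat) e1) as (e0 & D0 & A0); eauto; [intros; apply H1; [lia|assumption]|].
  exists (fun k => match k with 0%nat => e0 | 1%nat => e1 | 2%nat => e2 | 3%nat => e3 | _ => e4 end).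
  split; [split|split].
  - intros k x Hk. destruct k as [|[|[|[|k]]]]; [apply D0|apply D1|apply D2|apply D3|lia].
  - exact C4.
  - intros x Hx. rewrite A0 by exact Hx. now apply H0.
  - exact A4.
Qed.

Lemma chain_continuous e k x : deriv_chain e -> (k <= 4)%nat -> continuous (e k) x.
Proof.
  intros [H1 H2] Hk. destruct (Nat.eq_dec k 4) as [->|]; [apply H2|].
  apply (ex_derive_continuous (e k)). eexists. apply H1. lia.
Qed.

(** Four integrations by parts against the quartic kernel whose derivatives of orders 0 to 3 at [a]
    are [c0] to [c3]. As the kernel is nonpositive, replacing [e 4] by its lower bound [mn]
    increases the integral. *)
Lemma peano_cell e a b c0 c1 c2 c3 mn : deriv_chain e -> a <= b ->
  (forall z, 0 <= z <= b - a -> c0 + c1 * z + c2 * z ^ 2 / 2 + c3 * z ^ 3 / 6 + z ^ 4 / 24 <= 0) ->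
  (forall x, a <= x <= b -> mn <= e 4%nat x) ->
  let h := b - a in
  RInt (e 0%nat) a b <=
    mn * (c0 * h + c1 * h ^ 2 / 2 + c2 * h ^ 3 / 6 + c3 * h ^ 4 / 24 + h ^ 5 / 120)
    - (c0 + c1 * h + c2 * h ^ 2 / 2 + c3 * h ^ 3 / 6 + h ^ 4 / 24) * e 3%nat b
    + (c1 + c2 * h + c3 * h ^ 2 / 2 + h ^ 3 / 6) * e 2%nat b
    - (c2 + c3 * h + h ^ 2 / 2) * e 1%nat b
    + (c3 + h) * e 0%nat b
    + c0 * e 3%nat a - c1 * e 2%nat a + c2 * e 1%nat a - c3 * e 0%nat a.
Proof.
  intros He Hab Hk Hm. cbv zeta.
  set (kp := fun x => c0 + c1 * (x - a) + c2 * (x - a) ^ 2 / 2 + c3 * (x - a) ^ 3 / 6 + (x - a) ^ 4 / 24).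
  set (Dp := fun x =>
    mn * (c0 * (x - a) + c1 * (x - a) ^ 2 / 2 + c2 * (x - a) ^ 3 / 6 + c3 * (x - a) ^ 4 / 24 + (x - a) ^ 5 / 120)
    - (c0 + c1 * (x - a) + c2 * (x - a) ^ 2 / 2 + c3 * (x - a) ^ 3 / 6 + (x - a) ^ 4 / 24) * e 3%nat x
    + (c1 + c2 * (x - a) + c3 * (x - a) ^ 2 / 2 + (x - a) ^ 3 / 6) * e 2%nat x
    - (c2 + c3 * (x - a) + (x - a) ^ 2 / 2) * e 1%nat x
    + (c3 + (x - a)) * e 0%nat x).
  assert (HD : forall x, is_derive Dp x (mn * kp x - kp x * e 4%nat x + e 0%nat x)).
  { intros x. unfold Dp, kp.
    destruct He as [He _].
    auto_derive.
    - repeat split; eexists; apply He; lia.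
    - assert (E : forall k, (k < 4)%nat -> Derive (fun x : R => e k x) x = e (S k) x).
      { intros k Hk4. now apply is_derive_unique, He. }
      rewrite !E by lia. field. }
  assert (Hkc : forall x, continuous kp x).
  { intros x. apply (ex_derive_continuous kp). unfold kp. auto_derive. repeat split. }
  assert (Hcont : forall x, continuous (fun x => mn * kp x - kp x * e 4%nat x + e 0%nat x) x).
  { intros x. apply (continuous_plus (fun x => mn * kp x - kp x * e 4%nat x) (e 0%nat));
      [|apply chain_continuous; [exact He|lia]].
    apply (continuous_minus (fun x => mn * kp x) (fun x => kp x * e 4%nat x)).
    - apply (continuous_scal_r mn kp), Hkc.
    - apply (continuous_mult kp (e 4%nat)); [apply Hkc|apply chain_continuous; [exact He|lia]]. }
  assert (HI : is_RInt (fun x => mn * kp x - kp x * e 4%nat x + e 0%nat x) a b (Dp b - Dp a)).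
  { apply (is_RInt_derive Dp); intros x _; [apply HD|apply Hcont]. }
  eapply Rle_trans.
  - apply (RInt_le (e 0%nat) (fun x => mn * kp x - kp x * e 4%nat x + e 0%nat x)); [exact Hab| | |].
    + apply (ex_RInt_continuous (e 0%nat)). intros; apply chain_continuous; [exact He|lia].
    + eexists; exact HI.
    + intros x Hx. specialize (Hk (x - a) ltac:(lra)). specialize (Hm x ltac:(lra)).
      fold (kp x) in Hk. nra.
  - rewrite (is_RInt_unique _ _ _ _ HI). unfold Dp. right. field.
Qed.

Lemma INR_ge_3 n : (3 <= n)%nat -> 3 <= INR n.
Proof. intros H. replace 3 with (INR 3) by (simpl; ring). now apply le_INR. Qed.

(* The part of the boundary term [K e3 - K' e2 + K'' e1 - K''' e0] of the integration by
   parts at a node [k h], [1 <= k <= n - 1], which is common to both sides of the node. *)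
Definition node_term h (e : nat -> R -> R) x := - h ^ 4 / 384 * e 3%nat x + h ^ 2 / 12 * e 1%nat x.

Lemma end_block_upper e h mn : deriv_chain e -> 0 < h ->
  (forall x, 0 <= x <= h -> mn <= e 4%nat x) ->
  RInt (e 0%nat) 0 h <= mn * (- 71 / 103680 * h ^ 5) - node_term h e h
    + h * (43 / 384 * e 0%nat 0 + 69 / 128 * e 0%nat (h / 3) - 21 / 128 * e 0%nat (2 * h / 3)
           + 197 / 384 * e 0%nat h).
Proof.
  intros He Hh Hm.
  assert (Hex : forall a b, ex_RInt (e 0%nat) a b).
  { intros a b. apply (ex_RInt_continuous (e 0%nat)). intros; apply chain_continuous; [exact He|lia]. }
  assert (Scale : forall z, 0 <= z <= h / 3 -> exists t, z = h * t /\ 0 <= t <= 1 / 3).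
  { intros z Hz. exists (z / h). split; [field; lra|]. split; [apply le_div|apply div_le]; lra. }
  assert (Hh4 : 0 < h ^ 4) by (apply pow_lt; lra).
  (* The kernel starts at 0 with vanishing derivatives up to order 2, has fourth derivative 1, and
     at each node its third derivative drops by the weight. The constants are its data at the left
     end of each third; at [h] they match the periodic interior kernel, and the weight left there is
     [389 / 384 - 1 / 2 = 197 / 384]. *)
  pose proof (peano_cell e 0 (h / 3) 0 0 0 (- 43 / 384 * h) mn He ltac:(lra)) as C1.
  pose proof (peano_cell e (h / 3) (2 * h / 3) (- 11 / 62208 * h ^ 4) (- 1 / 20736 * h ^ 3)
    (7 / 384 * h ^ 2) (- 61 / 192 * h) mn He ltac:(lra)) as C2.
  pose proof (peano_cell e (2 * h / 3) h (- 13 / 20736 * h ^ 4) (- 113 / 20736 * h ^ 3)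
    (- 37 / 1152 * h ^ 2) (23 / 128 * h) mn He ltac:(lra)) as C3.
  cbv zeta in C1, C2, C3.
  assert (X1 := C1 ltac:(
    intros z Hz; destruct (Scale z ltac:(lra)) as (t & -> & Ht);
    replace (0 + 0 * (h * t) + 0 * (h * t) ^ 2 / 2 + - 43 / 384 * h * (h * t) ^ 3 / 6 + (h * t) ^ 4 / 24)
      with (- (h ^ 4 * (t ^ 3 * (43 / 2304 - t / 24)))) by field;
    assert (0 <= h ^ 4 * (t ^ 3 * (43 / 2304 - t / 24)))
      by (repeat apply Rmult_le_pos; try apply pow_le; lra); lra)
    ltac:(intros x Hx; apply Hm; lra)).
  assert (X2 := C2 ltac:(
    intros z Hz; destruct (Scale z ltac:(lra)) as (t & -> & Ht);
    replace (- 11 / 62208 * h ^ 4 + - 1 / 20736 * h ^ 3 * (h * t) + 7 / 384 * h ^ 2 * (h * t) ^ 2 / 2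
       + - 61 / 192 * h * (h * t) ^ 3 / 6 + (h * t) ^ 4 / 24)
      with (- (h ^ 4 * (11 / 62208 + t / 20736 - 7 / 768 * t ^ 2 + 61 / 1152 * t ^ 3 - t ^ 4 / 24))) by field;
    assert (0 <= h ^ 4 * (11 / 62208 + t / 20736 - 7 / 768 * t ^ 2 + 61 / 1152 * t ^ 3 - t ^ 4 / 24))
      by (apply Rmult_le_pos; [lra|];
          assert (0 <= t ^ 3 * (1 / 3 - t)) by (apply Rmult_le_pos; [apply pow_le|]; lra);
          (* After [t ^ 4] is absorbed by the previous line, [45 / 1152 * t ^ 3 - 7 / 768 * t ^ 2]
             remains, with minimum at [t = 7 / 45]. *)
          assert (0 <= (t - 7 / 45) ^ 2 * (t + 7 / 90)) by (apply Rmult_le_pos; [apply pow2_ge_0|lra]);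
          assert (0 <= t ^ 2) by (apply pow_le; lra); assert (0 <= t ^ 3) by (apply pow_le; lra);
          lra); lra)
    ltac:(intros x Hx; apply Hm; lra)).
  assert (X3 := C3 ltac:(
    intros z Hz; destruct (Scale z ltac:(lra)) as (t & -> & Ht);
    replace (- 13 / 20736 * h ^ 4 + - 113 / 20736 * h ^ 3 * (h * t) + - 37 / 1152 * h ^ 2 * (h * t) ^ 2 / 2
       + 23 / 128 * h * (h * t) ^ 3 / 6 + (h * t) ^ 4 / 24)
      with (- (h ^ 4 * (13 / 20736 + 113 / 20736 * t + 37 / 2304 * t ^ 2 - 23 / 768 * t ^ 3 - t ^ 4 / 24))) by field;
    assert (0 <= h ^ 4 * (13 / 20736 + 113 / 20736 * t + 37 / 2304 * t ^ 2 - 23 / 768 * t ^ 3 - t ^ 4 / 24))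
      by (apply Rmult_le_pos; [lra|];
          assert (0 <= t ^ 2 * (1 / 3 - t)) by (apply Rmult_le_pos; [apply pow_le|]; lra);
          assert (0 <= t ^ 3 * (1 / 3 - t)) by (apply Rmult_le_pos; [apply pow_le|]; lra);
          assert (0 <= t ^ 2) by (apply pow_le; lra);
          lra); lra)
    ltac:(intros x Hx; apply Hm; lra)).
  clear C1 C2 C3.
  rewrite <- (RInt_Chasles (e 0%nat) 0 (h / 3) h), <- (RInt_Chasles (e 0%nat) (h / 3) (2 * h / 3) h) by apply Hex.
  unfold plus; simpl plus. unfold node_term.
  change (RInt (e 0%nat) 0 (h / 3) + (RInt (e 0%nat) (h / 3) (2 * h / 3) + RInt (e 0%nat) (2 * h / 3) h)
    <= mn * (- 71 / 103680 * h ^ 5) - (- h ^ 4 / 384 * e 3%nat h + h ^ 2 / 12 * e 1%nat h) +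
     h * (43 / 384 * e 0%nat 0 + 69 / 128 * e 0%nat (h / 3) - 21 / 128 * e 0%nat (2 * h / 3) + 197 / 384 * e 0%nat h)).
  eapply Rle_trans.
  - apply Rplus_le_compat; [exact X1|apply Rplus_le_compat; [exact X2|exact X3]].
  - right. field.
Qed.

Lemma interior_cell_upper e h mn a b : deriv_chain e -> 0 < h -> b = a + h ->
  (forall x, a <= x <= b -> mn <= e 4%nat x) ->
  RInt (e 0%nat) a b <= mn * (- 7 / 5760 * h ^ 5) + node_term h e a - node_term h e b
    + h / 2 * (e 0%nat a + e 0%nat b).
Proof.
  intros He Hh -> Hm.
  eapply Rle_trans.
  - apply (peano_cell e a (a + h) (- h ^ 4 / 384) 0 (h ^ 2 / 12) (- h / 2) mn He); [lra| |exact Hm].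
    intros z Hz.
    replace (- h ^ 4 / 384 + 0 * z + h ^ 2 / 12 * z ^ 2 / 2 + - h / 2 * z ^ 3 / 6 + z ^ 4 / 24)
      with ((z * (h - z) - h ^ 2 / 4) * (z * (h - z) + h ^ 2 / 4) / 24) by field.
    assert (0 <= (z - h / 2) ^ 2) by apply pow2_ge_0.
    assert (0 <= z * (h - z)) by (apply Rmult_le_pos; lra).
    nra.
  - right. unfold node_term. field.
Qed.

(** The node terms telescope, and the trapezoidal rule remains. *)
Lemma interior_blocks_upper e n mn j : deriv_chain e -> (1 <= n)%nat -> (j + 1 <= n)%nat ->
  (forall x, 0 <= x <= 1 -> mn <= e 4%nat x) ->
  let h := 1 / INR n in
  RInt (e 0%nat) h (INR (S j) / INR n) <=
    mn * INR j * (- 7 / 5760 * h ^ 5) + node_term h e h - node_term h e (INR (S j) / INR n)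
    + h * sum_n_m (fun k => e 0%nat (INR k / INR n)) 1 (S j)
    - h / 2 * (e 0%nat h + e 0%nat (INR (S j) / INR n)).
Proof.
  intros He Hn Hj Hm. cbv zeta.
  assert (Hn0 : 0 < INR n) by (apply lt_0_INR; lia).
  assert (Hex : forall a b, ex_RInt (e 0%nat) a b).
  { intros a b. apply (ex_RInt_continuous (e 0%nat)). intros; apply chain_continuous; [exact He|lia]. }
  induction j as [|j IH].
  - rewrite sum_n_n. change (INR 1) with 1. rewrite RInt_point. change zero with 0.
    right. simpl INR. field. lra.
  - specialize (IH ltac:(lia)).
    rewrite <- (RInt_Chasles (e 0%nat) (1 / INR n) (INR (S j) / INR n)) by apply Hex.
    rewrite (sum_n_Sm _ 1 (S j)) by lia.
    pose proof (interior_cell_upper e (1 / INR n) mn (INR (S j) / INR n) (INR (S (S j)) / INR n) He) as X.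
    assert (Hle : INR (S (S j)) <= INR n) by (apply le_INR; lia).
    pose proof (pos_INR (S j)) as Hp.
    specialize (X ltac:(apply Rdiv_lt_0_compat; lra)
       ltac:(rewrite (S_INR (S j)); field; lra)).
    assert (Y : forall x, INR (S j) / INR n <= x <= INR (S (S j)) / INR n -> mn <= e 4%nat x).
    { intros x [Hx1 Hx2]. apply Hm.
      assert (0 <= INR (S j) / INR n) by (apply le_div; lra).
      assert (INR (S (S j)) / INR n <= 1) by (apply div_le; lra). lra. }
    specialize (X Y).
    match goal with |- plus ?a ?b <= _ => change (plus a b) with (a + b) end.
    match goal with |- context [plus ?a ?b] => change (plus a b) with (a + b) end.
    rewrite (S_INR j) in *.
    eapply Rle_trans; [apply Rplus_le_compat; [exact IH|exact X]|].
    right. field. lra.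
Qed.

Lemma deriv_chain_reflect e : deriv_chain e -> deriv_chain (fun k x => (-1) ^ k * e k (1 - x)).
Proof.
  intros [H1 H2]. split.
  - intros k x Hk. evar_last.
    + apply (is_derive_scal (fun x => e k (1 - x))).
      apply (is_derive_comp (e k) (fun x => 1 - x)); [now apply H1|].
      auto_derive; [exact I|reflexivity].
    + unfold scal; simpl; unfold Hierarchy.mult; simpl. ring.
  - intros x. apply (continuous_scal_r ((-1) ^ 4) (fun x => e 4%nat (1 - x))).
    apply (continuous_comp (fun x => 1 - x) (e 4%nat)); [|apply H2].
    apply (ex_derive_continuous (fun x => 1 - x)). auto_derive; exact I.
Qed.

(** The right end block is the left one for the reflected function. Reflection changes the sign of
    odd derivatives, so the node terms at [h] and [1 - h] cancel. *)
Lemma remainder_Q5_upper e n mn : deriv_chain e -> (3 <= n)%nat ->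
  (forall x, 0 <= x <= 1 -> mn <= e 4%nat x) ->
  remainder (Q5 n) (e 0%nat) <= - (7 / (5760 * INR n ^ 4)) * (1 - 55 / (63 * INR n)) * mn.
Proof.
  intros He Hn Hm.
  assert (Hn3 : 3 <= INR n) by (now apply INR_ge_3).
  assert (Hex : forall a b, ex_RInt (e 0%nat) a b).
  { intros a b. apply (ex_RInt_continuous (e 0%nat)). intros; apply chain_continuous; [exact He|lia]. }
  set (h := 1 / INR n).
  assert (Hh : 0 < h) by (apply Rdiv_lt_0_compat; lra).
  assert (Hh1 : h <= 1 / 3) by (apply div_le; lra).
  pose proof (end_block_upper e h mn He Hh ltac:(intros; apply Hm; lra)) as L1.
  pose proof (end_block_upper _ h mn (deriv_chain_reflect e He) Hh) as L3.
  cbv beta in L3.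
  assert (Hm' : forall x, 0 <= x <= h -> mn <= (-1) ^ 4 * e 4%nat (1 - x)).
  { intros x Hx. replace ((-1) ^ 4) with 1 by ring. rewrite Rmult_1_l. apply Hm. lra. }
  specialize (L3 Hm').
  pose proof (interior_blocks_upper e n mn (n - 2) He ltac:(lia) ltac:(lia) Hm) as L2.
  cbv zeta in L2. fold h in L2.
  assert (E1 : RInt (fun x => (-1) ^ 0 * e 0%nat (1 - x)) 0 h = RInt (e 0%nat) (1 - h) 1).
  { assert (R1 : is_RInt (fun x => scal (-1) (e 0%nat (-1 * x + 1))) h 0 (RInt (e 0%nat) (1 - h) 1)).
    { apply (is_RInt_comp_lin (e 0%nat)).
      replace (-1 * h + 1) with (1 - h) by ring. replace (-1 * 0 + 1) with 1 by ring.
      apply (RInt_correct (e 0%nat)), Hex. }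
    apply is_RInt_swap in R1.
    apply is_RInt_unique.
    apply (is_RInt_opp _ _ _ _) in R1. rewrite opp_opp in R1.
    eapply is_RInt_ext; [|exact R1].
    intros x _. unfold opp, scal; simpl; unfold Hierarchy.mult; simpl.
    replace (-1 * x + 1) with (1 - x) by ring. ring. }
  rewrite E1 in L3.
  replace (S (n - 2)) with (n - 1)%nat in L2 by lia.
  assert (En1 : INR (n - 1) / INR n = 1 - h).
  { rewrite minus_INR by lia. unfold h. simpl INR. field; lra. }
  rewrite En1 in L2.
  replace (INR (n - 2)) with (INR n - 2) in L2 by (rewrite minus_INR by lia; simpl; ring).
  assert (ES : sum_n_m (fun k => e 0%nat (INR k / INR n)) 1 (n - 1)
     = e 0%nat h + sum_n_m (fun k => e 0%nat (INR k / INR n)) 2 (n - 2) + e 0%nat (1 - h)).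
  { rewrite sum_Sn_m by lia. replace (n - 1)%nat with (S (n - 2)) by lia.
    rewrite sum_n_Sm by lia.
    change (INR 1) with 1. fold h.
    match goal with |- plus ?a (plus ?b ?c) = _ => change (a + (b + c) = e 0%nat h + b + e 0%nat (1 - h)) end.
    replace (INR (S (n - 2)) / INR n) with (1 - h)
      by (rewrite <- En1; do 2 f_equal; lia). ring. }
  rewrite ES in L2. clear ES.
  unfold remainder, Q5. cbv zeta.
  rewrite <- (RInt_Chasles (e 0%nat) 0 h 1), <- (RInt_Chasles (e 0%nat) h (1 - h) 1) by apply Hex.
  match goal with |- plus ?a (plus ?b ?c) - _ <= _ => change (plus a (plus b c)) with (a + (b + c)) end.
  replace (1 / INR n) with h by reflexivity.
  replace (1 / (3 * INR n)) with (h / 3) by (unfold h; field; lra).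
  replace (2 / (3 * INR n)) with (2 * h / 3) by (unfold h; field; lra).
  replace (43 / (384 * INR n)) with (43 / 384 * h) by (unfold h; field; lra).
  replace (69 / (128 * INR n)) with (69 / 128 * h) by (unfold h; field; lra).
  replace (21 / (128 * INR n)) with (21 / 128 * h) by (unfold h; field; lra).
  replace (389 / (384 * INR n)) with (389 / 384 * h) by (unfold h; field; lra).
  (* Two end blocks and [n - 2] cells: [71 / 103680] is [71 / 126] times [7 / 5760], and
     [n - 2 + 71 / 63 = n - 55 / 63]. *)
  replace (- (7 / (5760 * INR n ^ 4)) * (1 - 55 / (63 * INR n)) * mn)
    with (mn * (- 71 / 103680 * h ^ 5) + mn * (INR n - 2) * (- 7 / 5760 * h ^ 5) + mn * (- 71 / 103680 * h ^ 5))
    by (unfold h; field; lra).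
  unfold node_term in L1, L2, L3.
  rewrite !Rminus_0_r in *.
  lra.
Qed.

(** The indices from 4 to [n + 2] carry the multiples [k / n] with [k = i - 3], from [1 / n] to
    [1 - 1 / n]. *)
Definition Q5_node (n i : nat) : R :=
  let h := 1 / INR n in
  if Nat.eq_dec i 1 then 0 else if Nat.eq_dec i 2 then h / 3 else if Nat.eq_dec i 3 then 2 * h / 3
  else if Compare_dec.le_dec i (n + 2) then (INR i - 3) * h
  else if Nat.eq_dec i (n + 3) then 1 - 2 * h / 3
  else if Nat.eq_dec i (n + 4) then 1 - h / 3 else 1.

Definition Q5_weight (n i : nat) : R :=
  let h := 1 / INR n in
  if Nat.eq_dec i 1 then 43 / 384 * h else if Nat.eq_dec i 2 then 69 / 128 * h
  else if Nat.eq_dec i 3 then - 21 / 128 * h else if Nat.eq_dec i 4 then 389 / 384 * h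
  else if Compare_dec.le_dec i (n + 1) then h
  else if Nat.eq_dec i (n + 2) then 389 / 384 * h else if Nat.eq_dec i (n + 3) then - 21 / 128 * h
  else if Nat.eq_dec i (n + 4) then 69 / 128 * h else 43 / 384 * h.

Ltac decide_nat :=
  repeat match goal with
  | |- context [Nat.eq_dec ?a ?b] => destruct (Nat.eq_dec a b); try (exfalso; lia)
  | |- context [Compare_dec.le_dec ?a ?b] => destruct (Compare_dec.le_dec a b); try (exfalso; lia)
  end.

Lemma Q5_node_lt_S n i : (3 <= n)%nat -> (1 <= i)%nat -> (i < n + 5)%nat ->
  Q5_node n i < Q5_node n (S i).
Proof.
  intros Hn Hi Hi5. pose proof (INR_ge_3 n Hn) as Hn3.
  unfold Q5_node. set (h := 1 / INR n).
  assert (Hh : 0 < h) by (apply Rdiv_lt_0_compat; lra).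
  assert (Hnh : INR n * h = 1) by (unfold h; field; lra).
  destruct (Nat.eq_dec i (n + 2)) as [->|Hne].
  - decide_nat. rewrite plus_INR. simpl INR. lra.
  - decide_nat; subst; rewrite ?S_INR; simpl INR; lra.
Qed.

Lemma Q5_eq_sum n f : (3 <= n)%nat ->
  Q5 n f = sum_n_m (fun i => Q5_weight n i * f (Q5_node n i)) 1 (n + 5).
Proof.
  intros Hn. pose proof (INR_ge_3 n Hn) as Hn3.
  set (G := fun i => Q5_weight n i * f (Q5_node n i)).
  assert (ES : sum_n_m G 1 (n + 5) =
     G 1%nat + (G 2%nat + (G 3%nat + (G 4%nat +
       (sum_n_m G 5 (n + 1) + G (n + 2)%nat + G (n + 3)%nat + G (n + 4)%nat + G (n + 5)%nat))))).
  { rewrite (sum_Sn_m G 1), (sum_Sn_m G 2), (sum_Sn_m G 3), (sum_Sn_m G 4) by lia.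
    replace (n + 5)%nat with (S (n + 4)) by lia. rewrite (sum_n_Sm G 5 (n + 4)) by lia.
    replace (n + 4)%nat with (S (n + 3)) by lia. rewrite (sum_n_Sm G 5 (n + 3)) by lia.
    replace (n + 3)%nat with (S (n + 2)) by lia. rewrite (sum_n_Sm G 5 (n + 2)) by lia.
    replace (n + 2)%nat with (S (n + 1)) by lia. rewrite (sum_n_Sm G 5 (n + 1)) by lia.
    reflexivity. }
  rewrite ES.
  assert (EM : sum_n_m G 5 (n + 1) = 1 / INR n * sum_n_m (fun k => f (INR k / INR n)) 2 (n - 2)).
  { replace (n + 1)%nat with (S (S (S (n - 2)))) by lia.
    rewrite <- !(sum_n_m_S _ _ _).
    rewrite <- (sum_n_m_mult_l (K := R_Ring) (1 / INR n)).
    apply sum_n_m_ext_loc. intros k Hk. unfold G, Q5_weight, Q5_node.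
    decide_nat. change (@Hierarchy.mult R_Ring) with Rmult. do 2 f_equal.
    rewrite !S_INR. field. lra. }
  rewrite EM. unfold G, Q5_weight, Q5_node, Q5. cbv zeta.
  replace (INR (n + 2)) with (INR n + 2) by (rewrite plus_INR; simpl; ring).
  decide_nat.
  replace ((INR 4 - 3) * (1 / INR n)) with (1 / INR n) by (simpl; field; lra).
  replace ((INR n + 2 - 3) * (1 / INR n)) with (1 - 1 / INR n) by (field; lra).
  replace (1 / (3 * INR n)) with (1 / INR n / 3) by (field; lra).
  replace (2 / (3 * INR n)) with (2 * (1 / INR n) / 3) by (field; lra).
  rewrite !Rminus_0_r. field. lra.
Qed.

Lemma Q5_is_quadrature n : (3 <= n)%nat -> is_quadrature (n + 5) (Q5 n).
Proof.
  intros Hn. exists (Q5_weight n), (Q5_node n).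
  assert (Hlt : forall i j, (1 <= i)%nat -> (i < j)%nat -> (j <= n + 5)%nat ->
     Q5_node n i < Q5_node n j).
  { intros i j Hi Hij. induction Hij as [|j Hij IH]; intros Hj.
    - apply Q5_node_lt_S; lia.
    - eapply Rlt_trans; [apply IH; lia|]. apply Q5_node_lt_S; lia. }
  assert (H1 : Q5_node n 1 = 0) by (unfold Q5_node; decide_nat; reflexivity).
  assert (H5 : Q5_node n (n + 5) = 1) by (unfold Q5_node; cbv zeta; decide_nat; reflexivity).
  split; [|split; [exact Hlt|intros f; now apply Q5_eq_sum]].
  intros i Hi. split; [rewrite <- H1|rewrite <- H5].
  - destruct (Nat.eq_dec i 1) as [->|]; [lra|]. left. apply Hlt; lia.
  - destruct (Nat.eq_dec i (n + 5)) as [->|]; [lra|]. left. apply Hlt; lia.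
Qed.

Lemma remainder_ext_I01 N Q f g : is_quadrature N Q -> (forall x, I01 x -> f x = g x) ->
  remainder Q f = remainder Q g.
Proof.
  intros (a & tau & Ht & _ & HQ) H. unfold remainder. rewrite !HQ. f_equal.
  - apply RInt_ext. intros x Hx. rewrite Rmin_left, Rmax_right in Hx by lra.
    apply H. unfold I01; lra.
  - apply sum_n_m_ext_loc. intros i Hi. now rewrite H by now apply Ht.
Qed.

(** The negative is written in the shape to which [remainder_linear] applies. *)
Lemma deriv_chain_opp e : deriv_chain e -> deriv_chain (fun k x => 0 - 1 * e k x).
Proof.
  intros [H1 H2]. split.
  - intros k x Hk. apply (is_derive_minus (fun _ => 0) (fun x => 1 * e k x) x 0 (1 * e (S k) x)).
    + apply (is_derive_const (K := R_AbsRing) (V := R_NormedModule)).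
    + apply (is_derive_scal (e k)). now apply H1.
  - intros x. apply (continuous_minus (fun _ => 0) (fun x => 1 * e 4%nat x)).
    + apply continuous_const.
    + apply (continuous_scal_r 1 (e 4%nat)), H2.
Qed.

(** The upper bound for [e] and for its negative puts [r / c] between the minimum and the maximum of
    [e 4]; the intermediate value theorem gives [xi]. *)
Lemma Q5_negative_definite n : (3 <= n)%nat ->
  negative_definite4 (Q5 n) (- (7 / (5760 * INR n ^ 4)) * (1 - 55 / (63 * INR n))).
Proof.
  intros Hn. pose proof (INR_ge_3 n Hn) as Hn3.
  pose proof (Q5_is_quadrature n Hn) as HQ.
  set (c := - (7 / (5760 * INR n ^ 4)) * (1 - 55 / (63 * INR n))).
  assert (Hc : c < 0).
  { assert (0 < 7 / (5760 * INR n ^ 4)).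
    { apply Rdiv_lt_0_compat; [lra|]. apply Rmult_lt_0_compat; [lra|apply pow_lt; lra]. }
    assert (55 / (63 * INR n) <= 1 / 3) by (apply div_le; lra). unfold c. nra. }
  split; [exact Hc|]. intros f d Hd.
  destruct (extend_C4 f d Hd) as (e & He & E0 & E4).
  rewrite (remainder_ext_I01 (n + 5) _ f (e 0%nat)) by (auto; intros; now rewrite E0).
  set (r := remainder (Q5 n) (e 0%nat)).
  assert (C4 : forall x, continuity_pt (e 4%nat) x).
  { intros x. apply continuity_pt_filterlim, He. }
  destruct (continuity_ab_min (e 4%nat) 0 1 ltac:(lra) ltac:(intros; apply C4)) as (x1 & Hmin & Hx1).
  destruct (continuity_ab_maj (e 4%nat) 0 1 ltac:(lra) ltac:(intros; apply C4)) as (x2 & Hmax & Hx2).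
  assert (U : r <= c * e 4%nat x1) by (apply remainder_Q5_upper; assumption).
  assert (L : c * e 4%nat x2 <= r).
  { pose proof (remainder_Q5_upper _ n (- e 4%nat x2) (deriv_chain_opp e He) Hn) as L.
    cbv beta in L. fold c in L.
    rewrite (remainder_linear (n + 5) (Q5 n) (fun _ => 0) (e 0%nat)) in L;
      [|exact HQ|intros; apply continuous_const|intros; apply chain_continuous; [exact He|lia]].
    fold r in L.
    assert (Z : remainder (Q5 n) (fun _ => 0) = 0).
    { pose proof (remainder_linear (n + 5) (Q5 n) (fun _ => 0) (fun _ => 0) 1 HQ) as Z.
      specialize (Z ltac:(intros; apply continuous_const) ltac:(intros; apply continuous_const)).
      cbv beta in Z.
      replace (fun _ : R => 0 - 1 * 0) with (fun _ : R => 0) in Z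
        by (apply functional_extensionality; intros; ring). lra. }
    change (remainder (Q5 n) (fun _ : R_UniformSpace => 0) = 0) in Z. rewrite Z in L.
    assert (X : forall x, 0 <= x <= 1 -> - e 4%nat x2 <= 0 - 1 * e 4%nat x).
    { intros x Hx. specialize (Hmax x Hx). lra. }
    specialize (L X). lra. }
  destruct (IVT_gen (e 4%nat) x1 x2 (r / c)) as (xi & Hxi & Exi).
  - intros x. apply C4.
  - assert (e 4%nat x1 <= e 4%nat x2) by (apply Hmin, Hx2). rewrite Rmin_left, Rmax_right by lra.
    split; apply Rmult_le_reg_l with (- c); try lra;
      replace (- c * (r / c)) with (- r) by (field; lra); lra.
  - assert (HI : I01 xi).
    { unfold I01. unfold Rmin, Rmax in Hxi. destruct (Rle_dec x1 x2); lra. }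
    exists xi. split; [exact HI|]. rewrite <- E4 by exact HI. rewrite Exi. field. lra.
Qed.

(** * Asymptotic optimality *)

Lemma is_lim_seq_inv_INR : is_lim_seq (fun n => / INR n) 0.
Proof.
  replace (Finite 0) with (Rbar_inv p_infty) by reflexivity.
  apply is_lim_seq_inv; [apply is_lim_seq_INR|discriminate].
Qed.

Theorem mainTheorem4 :
  (forall n : nat, (3 <= n)%nat ->
     is_quadrature (n + 5) (Q5 n) /\
     negative_definite4 (Q5 n)
       (- (7 / (5760 * INR n ^ 4)) * (1 - 55 / (63 * INR n)))) /\
  asymptotically_optimal_negative4 (fun n : nat => (n + 5)%nat) Q5.
Proof.
  assert (Main : forall n : nat, (3 <= n)%nat ->
     is_quadrature (n + 5) (Q5 n) /\
     negative_definite4 (Q5 n)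
       (- (7 / (5760 * INR n ^ 4)) * (1 - 55 / (63 * INR n)))).
  { intros n Hn. split; [now apply Q5_is_quadrature|now apply Q5_negative_definite]. }
  split; [exact Main|].
  set (c := fun n => - (7 / (5760 * INR n ^ 4)) * (1 - 55 / (63 * INR n))) in *.
  exists c. split; [exists 3%nat; exact Main|].
  set (B := fun n => - 7 / (5760 * INR (n + 5 + 1) ^ 4) + 12 / (5760 * INR (n + 5 + 1) ^ 5)).
  assert (Hlim : is_lim_seq (fun n => c n / B n) 1).
  (* The quotient in the variable [u = 1 / n]: with [m = n + 6] one has [m = n * (1 + 6 * u)] and
     [7 * m - 12 = n * (7 + 30 * u)]. *)
  { set (g := fun u => (1 + 6 * u) ^ 5 * (1 - 55 / 63 * u) * 7 * / (7 + 30 * u)).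
    apply is_lim_seq_ext_loc with (fun n => g (/ INR n)).
    - exists 1%nat. intros n Hn. assert (0 < INR n) by (apply lt_0_INR; lia).
      unfold g, c, B. rewrite !plus_INR.
      replace (INR n + INR 5 + INR 1) with (INR n + 6) by (simpl; ring).
      field. repeat split; try lra.
    - replace 1 with (g 0) by (unfold g; field).
      apply (is_lim_seq_continuous g (fun n => / INR n) 0); [|apply is_lim_seq_inv_INR].
      apply continuity_pt_filterlim, (ex_derive_continuous g). unfold g. auto_derive. lra. }
  (* From [c n <= c_minus4 (n + 5) <= B n < 0] the quotient lies between 1 and [c n / B n]. *)
  apply is_lim_seq_le_le_loc with (fun _ => 1) (fun n => c n / B n);
    [|apply is_lim_seq_const|exact Hlim].
  exists 3%nat. intros n Hn. pose proof (INR_ge_3 n Hn) as Hn3.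
  destruct (Main n Hn) as [HQ HD].
  assert (Hlub : is_lub (fun x => exists Q, is_quadrature (n + 5) Q /\ negative_definite4 Q x)
     (c_minus4 (n + 5))).
  { apply Lub_real_is_lub with (c n) (B n).
    - exists (Q5 n). split; assumption.
    - intros x (Q & H1 & H2). now apply (error_constant_upper (n + 5) Q). }
  assert (H1 : c n <= c_minus4 (n + 5)) by (apply Hlub; exists (Q5 n); split; assumption).
  assert (H2 : c_minus4 (n + 5) <= B n).
  { apply Hlub. intros x (Q & HQ' & HD'). now apply (error_constant_upper (n + 5) Q). }
  assert (HB : B n < 0).
  { unfold B. rewrite !plus_INR. replace (INR n + INR 5 + INR 1) with (INR n + 6) by (simpl; ring).
    set (m := INR n + 6). assert (Hm : 9 <= m) by (unfold m; lra).
    replace (- 7 / (5760 * m ^ 4) + 12 / (5760 * m ^ 5)) with (- ((7 * m - 12) / (5760 * m ^ 5))) by (field; lra).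
    assert (0 < (7 * m - 12) / (5760 * m ^ 5)); [|lra].
    apply Rdiv_lt_0_compat; [lra|]. apply Rmult_lt_0_compat; [lra|apply pow_lt; lra]. }
  set (s := c_minus4 (n + 5)) in *.
  replace (c n / s) with (- c n / - s) by (field; lra).
  replace (c n / B n) with (- c n / - B n) by (field; lra).
  split.
  - apply le_div; lra.
  - unfold Rdiv. apply Rmult_le_compat_l; [lra|]. apply Rinv_le_contravar; lra.
Qed.
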